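(* Let $n\ge 2$ and let $K\in\mathcal{K}_o^n$ with $V(K)=2$. Then $\frac{2|p|}{n^2V(\mathrm{I}_pK)}\mathcal{I}_p(K,\cdot)$ converges to the cone-volume measure $V_K(\cdot)$ as $p\to 0$.
   Context: A convex body is a compact convex subset of $\mathbb{R}^n$ with nonempty interior; $\mathcal{K}_o^n$ is the set of convex bodies containing the origin in their interiors. $V$ is $n$-dimensional volume. For $K\in\mathcal{K}_o^n$, the support function is $h_K(v)=\max\{x\cdot v: x\in K\}$, $v\in S^{n-1}$, and for a compact set $K$ star-shaped with respect to the origin the radial function is $\rho_K(x)=\max\{t\ge 0: tx\in K\}$, $x\in\mathbb{R}^n\setminus\{o\}$. A star body is a compact star-shaped set (with respect to the origin) whose radial function is continuous and positive on $S^{n-1}$. Spherical Lebesgue measure is denoted $du$, $dv$. $L_p$ intersection body: for $p\in(-\infty,0)\cup(0,1)$ and a body $K$ (star body, in particular $K\in\mathcal{K}_o^n$), $\mathrm{I}_pK$ is the star body with radial function $$\rho_{\mathrm{I}_pK}(x)=\Big(\frac{1-p}{2}\int_K|x\cdot y|^{-p}\,dy\Big)^{1/p},\qquad x\in\mathbb{R}^n\setminus\{o\}.$$ $q$-cosine transform: for $q>-1$ and $f\in C(S^{n-1})$, $T_qf(u)=\int_{S^{n-1}}f(v)|u\cdot v|^q\,dv$, $u\in S^{n-1}$. Reverse radial Gauss image: for $K\in\mathcal{K}_o^n$ and $\eta\subset S^{n-1}$, $\boldsymbol{\alpha}_K^*(\eta)=\bigcup_{v\in\eta}\{u\in S^{n-1}:\rho_K(u)\,u\cdot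 v=h_K(v)\}$. $p$-affine dual curvature measure: for $K\in\mathcal{K}_o^n$, $p\in(-\infty,0)\cup(0,1)$ and Borel $\eta\subset S^{n-1}$, $$\mathcal{I}_p(K,\eta)=\frac{1-p}{2|p|}\int_{\boldsymbol{\alpha}_K^*(\eta)}\rho_K^{n-p}(v)\,T_{-p}\rho_{\mathrm{I}_pK}^{n-p}(v)\,dv .$$ Cone-volume measure: $V_K(\eta)=\frac1n\int_{\boldsymbol{\alpha}_K^*(\eta)}\rho_K^n(v)\,dv$ for Borel $\eta\subset S^{n-1}$. *)

(* Defs.v *)
From HB Require Import structures.
From mathcomp Require Import all_boot all_order all_algebra.
From mathcomp Require Import all_classical all_reals all_analysis.
From mathcomp Require Import measurable_realfun.

Set Implicit Arguments.
Unset Strict Implicit.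
Unset Printing Implicit Defensive.

Import Order.TTheory GRing.Theory Num.Theory.
Import numFieldNormedType.Exports.

Local Open Scope classical_set_scope.
Local Open Scope ring_scope.

Section borel_rV.
Variables (R : realType) (n : nat).

HB.instance Definition _ := @isMeasurable.Build
  (sigma_display (@open 'rV[R]_n)) 'rV[R]_n <<s @open 'rV[R]_n >>
  (@sigma_algebra0 _ setT _) (@sigma_algebraC 'rV[R]_n _)
  (@sigma_algebra_bigcup _ setT _).

Lemma open_measurable_rV (U : set 'rV[R]_n) : open U -> measurable U.
Proof. by move=> oU; apply: sub_sigma_algebra. Qed.

Lemma continuous_measurable_rV (f : 'rV[R]_n -> R) :
  continuous f -> measurable_fun [set: 'rV[R]_n] f.
Proof.
move=> cf; apply: (measurability _ (RGenOpens.measurableE R)).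
move=> _ [_ [a [b ->] <-]]; rewrite setTI; apply: open_measurable_rV.
by move/continuousP : cf; apply; exact: interval_open.
Qed.

Lemma measurable_coord_rV (i : 'I_n) :
  measurable_fun [set: 'rV[R]_n] (fun x : 'rV[R]_n => x 0 i).
Proof. by apply: continuous_measurable_rV; exact: coord_continuous. Qed.

Let ratv (q : 'rV[rat]_n) : 'rV[R]_n := map_mx ratr q.

Lemma open_rVE (U : set 'rV[R]_n) : open U ->
  U = \bigcup_(qk in [set qk : 'rV[rat]_n * nat |
        ball (ratv qk.1) qk.2.+1%:R^-1 `<=` U])
      ball (ratv qk.1) qk.2.+1%:R^-1.
Proof.
move=> oU; apply/seteqP; split=> [x Ux|x [qk]]; last exact.
have /nbhs_ballP[e /= e0 xeU] : nbhs x U by exact: open_nbhs_nbhs.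
have [k] : exists k, k.+1%:R^-1 < e / 2.
  by exists (Num.trunc (e / 2)^-1); rewrite invf_plt ?posrE ?divr_gt0//;
    exact: truncnS_gt.
set d := _^-1 => de.
have d0 : 0 < d :> R by rewrite invr_gt0.
have /choice[q qP] (i : 'I_n) : exists q : rat, ball (x 0 i) d (ratr q : R).
  have /rat_in_itvoo[q] : x 0 i - d < x 0 i + d by rewrite ltrBlDr -addrA ltrDl addr_gt0.
  rewrite in_itv/= => /andP[q1 q2]; exists q.
  by rewrite /ball/= distrC ltr_distl q1.
have xq : ball x d (ratv (\row_i q i)).
  by split => // i j; rewrite !mxE ord1; exact: qP.
exists (\row_i q i, k); last exact: ball_sym.
move=> y /= qy; apply: xeU; apply: le_ball (ball_triangle xq qy).
by rewrite (splitr e) lerD// ltW.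
Qed.

Lemma measurable_rVP d (T : measurableType d) (f : T -> 'rV[R]_n) :
  measurable_fun [set: T] f <->
  forall i, measurable_fun [set: T] (fun x => f x 0 i).
Proof.
split=> [mf i|mf].
  exact: (measurableT_comp (measurable_coord_rV i) mf).
apply: (@measurability _ _ _ _ _ _ (@open 'rV[R]_n)) => // _ [U oU <-].
rewrite setTI (open_rVE oU) preimage_bigcup bigcup_mkcond.
apply: countable_bigcupT_measurable => // -[q k]; case: ifP => // _.
rewrite (_ : _ @^-1` _ = \bigcap_(i in [set: 'I_n])
    ((fun x => f x 0 i) @^-1` (ball (ratr (q 0 i) : R) k.+1%:R^-1))).
  apply: fin_bigcap_measurable => [|i _]; first exact: finite_finset.
  rewrite -[X in measurable X]setTI; apply: mf => //.
  by apply: open_measurable; exact: ball_open.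
apply/seteqP; split=> [x [_ fx] i _|x fx].
  by have := fx 0 i; rewrite mxE.
by split=> [|i j]; rewrite ?invr_gt0// ord1 mxE; exact: fx.
Qed.

End borel_rV.

Section lebesgue_rV.
Variable R : realType.

Definition cons_rV n (x : R * 'rV[R]_n) : 'rV[R]_n.+1 :=
  \row_i oapp (x.2 0) x.1 (unlift ord0 i).

Definition uncons_rV n (x : 'rV[R]_n.+1) : R * 'rV[R]_n :=
  (x 0 ord0, \row_j x 0 (lift ord0 j)).

Lemma uncons_rVK n : cancel (@uncons_rV n) (@cons_rV n).
Proof.
by move=> x; apply/rowP => i; rewrite mxE; case: unliftP => [j|] ->//=; rewrite mxE.
Qed.

Lemma cons_rVK n : cancel (@cons_rV n) (@uncons_rV n).
Proof.
move=> [t y]; rewrite /uncons_rV mxE unlift_none/=; congr pair.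
by apply/rowP => j; rewrite !mxE liftK.
Qed.

Lemma measurable_cons_rV n : measurable_fun setT (@cons_rV n).
Proof.
apply/measurable_rVP => i; under eq_fun do rewrite mxE.
case: unliftP => [j|] _ /=; last exact: measurable_fst.
apply: (measurableT_comp (measurable_coord_rV j)); exact: measurable_snd.
Qed.

Lemma measurable_uncons_rV n : measurable_fun setT (@uncons_rV n).
Proof.
apply: measurable_fun_pair; first exact: measurable_coord_rV.
apply/measurable_rVP => i; under eq_fun do rewrite mxE.
exact: measurable_coord_rV.
Qed.

Section step.
Variables (n : nat) (mu : {sigma_finite_measure set 'rV[R]_n -> \bar R}).

Definition lebesgue_rV_step : set 'rV[R]_n.+1 -> \bar R :=
  pushforward (@lebesgue_measure R \x mu)%E (@cons_rV n).

Let mcons := @measurable_cons_rV n.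

Let step0 : lebesgue_rV_step set0 = 0%E.
Proof. by have := mcons; rewrite /lebesgue_rV_step => mf; rewrite measure0. Qed.

Let step_ge0 A : (0 <= lebesgue_rV_step A)%E.
Proof. by have := mcons; rewrite /lebesgue_rV_step => mf; exact: measure_ge0. Qed.

Let step_sigma_additive : semi_sigma_additive lebesgue_rV_step.
Proof.
have := mcons; rewrite /lebesgue_rV_step => mf.
exact: measure_semi_sigma_additive.
Qed.

HB.instance Definition _ :=
  isMeasure.Build _ _ _ lebesgue_rV_step step0 step_ge0 step_sigma_additive.

Let step_sigma_finite : sigma_finite setT lebesgue_rV_step.
Proof.
have /sigma_finiteP[F [FT ndF Foo]] : sigma_finite setT (@lebesgue_measure R).
  exact: sigma_finiteT.
have /sigma_finiteP[G [GT ndG Goo]] : sigma_finite setT mu by [].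
exists (fun k => @uncons_rV n @^-1` (F k `*` G k)) => [|k].
  apply/seteqP; split=> // x _.
  have [i _ Fi] : (\bigcup_i F i) (uncons_rV x).1 by rewrite -FT.
  have [j _ Gj] : (\bigcup_j G j) (uncons_rV x).2 by rewrite -GT.
  exists (maxn i j) => //; split.
    by move: Fi; exact/subsetPset/ndF/leq_maxl.
  by move: Gj; exact/subsetPset/ndG/leq_maxr.
have [mF Fk] := Foo k; have [mG Gk] := Goo k; split.
  rewrite -[X in measurable X]setTI; apply: measurable_uncons_rV => //.
  exact: measurableX.
rewrite /lebesgue_rV_step /pushforward -comp_preimage.
rewrite (_ : _ \o _ = id) ?preimage_id; last exact/funext/cons_rVK.
by rewrite product_measure1E// lte_mul_pinfty// ge0_fin_numE.
Qed.

HB.instance Definition _ :=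
  Measure_isSigmaFinite.Build _ _ _ lebesgue_rV_step step_sigma_finite.

End step.

Fixpoint lebesgue_rV n : {sigma_finite_measure set 'rV[R]_n -> \bar R} :=
  if n is n.+1 then lebesgue_rV_step (lebesgue_rV n) else dirac (0 : 'rV[R]_0).

Lemma lebesgue_rV_box n (A : 'I_n -> set R) :
  (forall i, measurable (A i)) ->
  lebesgue_rV n [set x | forall i, A i (x 0 i)] =
  (\prod_(i < n) lebesgue_measure (A i))%E.
Proof.
elim: n A => [|n IHn] A mA.
  by rewrite big_ord0/= diracE mem_set// => -[].
rewrite big_ord_recl -IHn//.
pose B := [set x : 'rV[R]_n | forall i, A (lift ord0 i) (x 0 i)].
have mB : measurable B.
  rewrite (_ : B = \bigcap_(i in [set: 'I_n])
      ((fun x : 'rV[R]_n => x 0 i) @^-1` A (lift ord0 i))).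
    apply: fin_bigcap_measurable => [|i _]; first exact: finite_finset.
    by rewrite -[X in measurable X]setTI; apply: measurable_coord_rV => //.
  by apply/seteqP; split=> x /= xA i; [move=> _|]; exact: xA.
rewrite -(product_measure1E _ _ _ mB); last exact: mA.
rewrite /= /lebesgue_rV_step /pushforward.
congr (_ _); apply/seteqP; split=> [[t y] /= tyA|[t y] /= [tA yA] i].
  split=> [|i]/=; first by have := tyA ord0; rewrite mxE unlift_none.
  by have := tyA (lift ord0 i); rewrite mxE liftK.
by rewrite mxE; case: unliftP => [j|] ->; [exact: yA|].
Qed.

End lebesgue_rV.

Section euclidean.
Variables (R : realType) (n : nat).
Implicit Types (x y u v : 'rV[R]_n) (A K : set 'rV[R]_n).

Definition dot x y : R := \sum_i x 0 i * y 0 i.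

Definition enorm x : R := Num.sqrt (dot x x).

Definition sphere : set 'rV[R]_n := [set u | enorm u = 1].

Definition volume A : R := fine (lebesgue_rV R n A).

Lemma dotZZ t x : dot (t *: x) (t *: x) = t ^+ 2 * dot x x.
Proof.
rewrite /dot mulr_sumr; apply: eq_bigr => i _.
by rewrite !mxE mulrACA -expr2.
Qed.

Lemma enormZ t x : 0 <= t -> enorm (t *: x) = t * enorm x.
Proof.
by move=> t0; rewrite /enorm dotZZ sqrtrM ?sqr_ge0// sqrtr_sqr ger0_norm.
Qed.

Lemma measurable_enorm : measurable_fun [set: 'rV[R]_n] enorm.
Proof.
apply: (@measurableT_comp _ _ _ _ _ _ (@Num.sqrt R)).
  by apply: continuous_measurable_fun; exact: sqrt_continuous.
apply: measurable_sum => i.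
by apply: measurable_funM; exact: measurable_coord_rV.
Qed.

Definition cone A : set 'rV[R]_n :=
  [set t *: u | t in `]0, 1]%classic & u in A `&` sphere].

(* Normalised by polar coordinates, dx = r ^ (n - 1) dr du: the cone over A
   has volume n^-1 times the spherical measure of A. This is a measure on the
   ambient space, carried by the sphere. *)
Definition sphere_measure A : \bar R := (n%:R%:E * lebesgue_rV R n (cone A))%E.

Let proj x := (enorm x)^-1 *: x.

Let pball := [set x | 0 < enorm x <= 1].

Let coneE A : cone A = proj @^-1` A `&` pball.
Proof.
apply/seteqP; split=> [_ [t]/= + [u [Au u1] <-]|x [/= Ax /andP[x0 x1]]].
  rewrite in_itv/= => /andP[t0 t1]; rewrite /pball/proj/= enormZ ?(ltW t0)// u1 mulr1 t0 t1.
  by rewrite scalerA mulVf ?scale1r ?gt_eqF.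
exists (enorm x); first by rewrite /= in_itv/= x0.
exists (proj x); last by rewrite scalerA divff ?scale1r ?gt_eqF.
by split=> //; rewrite /sphere/= enormZ ?invr_ge0 ?(ltW x0)// mulVf ?gt_eqF.
Qed.

Let mproj : measurable_fun setT proj.
Proof.
apply/measurable_rVP => i; under eq_fun do rewrite mxE.
apply: measurable_funM; last exact: measurable_coord_rV.
rewrite (_ : (fun _ => _) = (@powR R ^~ (-1)) \o enorm).
  by apply: measurableT_comp; [exact: measurable_powR|exact: measurable_enorm].
by apply/funext => x/=; rewrite powR_inv1 ?sqrtr_ge0.
Qed.

Let mpball : measurable pball.
Proof.
rewrite (_ : pball = enorm @^-1` `]0, 1]%classic).
  by rewrite -[X in measurable X]setTI; exact: measurable_enorm.
by apply/seteqP; split=> x /=; rewrite in_itv.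
Qed.

Let proj_measure : {measure set 'rV[R]_n -> \bar R} :=
  measure_function_pushforward__canonical__measure_function_Measure
    (mrestr (lebesgue_rV R n) mpball) mproj.

Let sphere_measureE : sphere_measure = mscale n%:R%:nng proj_measure.
Proof. by apply/funext => A; rewrite /sphere_measure coneE. Qed.

Let sphere_measure0 : sphere_measure set0 = 0%E.
Proof. by rewrite sphere_measureE measure0. Qed.

Let sphere_measure_ge0 A : (0 <= sphere_measure A)%E.
Proof. by rewrite sphere_measureE. Qed.

Let sphere_measure_sigma_additive : semi_sigma_additive sphere_measure.
Proof. by rewrite sphere_measureE; exact: measure_semi_sigma_additive. Qed.

HB.instance Definition _ := isMeasure.Build _ _ _ sphere_measure
  sphere_measure0 sphere_measure_ge0 sphere_measure_sigma_additive.

Definition convex_body K :=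
  [/\ compact K, convex_set (K : set (convex_lmodType 'rV[R]_n)) & K° !=set0].

Definition convex_body_o K := convex_body K /\ K° 0.

Definition support K v : R := sup [set dot x v | x in K].

Definition radial K x : R := sup [set t | 0 <= t /\ K (t *: x)].

Definition star_body (rho : 'rV[R]_n -> R) : set 'rV[R]_n :=
  [set x | exists2 u, sphere u & exists2 t, 0 <= t <= rho u & x = t *: u].

Lemma radial_star_body rho u : sphere u -> 0 <= rho u ->
  radial (star_body rho) u = rho u.
Proof.
move=> u1 r0; rewrite /radial (_ : [set t | _] = `[0, rho u]%classic).
  by rewrite sup_itvcc.
apply/seteqP; split=> t /=; rewrite in_itv/=.
  move=> [t0 [v v1 [s /andP[s0 sr] tusv]]].
  have ts : t = s by have := congr1 enorm tusv; rewrite !enormZ// u1 v1 !mulr1.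
  rewrite t0 ts; have [s_eq0|sN0] := eqVneq s 0; first by rewrite s_eq0.
  suff -> : u = v by [].
  by move: tusv; rewrite ts; exact: scalerI.
by move=> /andP[t0 tr]; split=> //; exists u => //; exists t; rewrite ?t0.
Qed.

(* powR 0 (- p) = 0, so for 0 < p the integrand is 0 instead of +oo on the
   null set where dot x y = 0; likewise in cosine_transform for q < 0. *)
Definition Lp_intersection_radial (p : R) K x : R :=
  ((1 - p) / 2 * \int[lebesgue_rV R n]_(y in K) (`|dot x y| `^ (- p))) `^ p^-1.

Definition Lp_intersection_body (p : R) K : set 'rV[R]_n :=
  star_body (Lp_intersection_radial p K).

Definition cosine_transform (q : R) (f : 'rV[R]_n -> R) u : R :=
  \int[sphere_measure]_(v in sphere) (f v * `|dot u v| `^ q).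

Definition reverse_radial_gauss K (eta : set 'rV[R]_n) : set 'rV[R]_n :=
  \bigcup_(v in eta)
    [set u | sphere u /\ radial K u * dot u v = support K v].

(* For Borel eta, reverse_radial_gauss K eta is measurable up to a null set of
   sphere_measure but need not be Borel. The integral of a nonnegative function
   is a supremum over the simple functions below it, so it agrees with the
   integral for the completion. *)
Definition affine_dual_curvature (p : R) K (eta : set 'rV[R]_n) : R :=
  (1 - p) / (2 * `|p|) *
  \int[sphere_measure]_(v in reverse_radial_gauss K eta)
    (radial K v `^ (n%:R - p) *
     cosine_transform (- p)
       (fun u => radial (Lp_intersection_body p K) u `^ (n%:R - p)) v).

Definition cone_volume K (eta : set 'rV[R]_n) : R :=
  n%:R^-1 *
  \int[sphere_measure]_(v in reverse_radial_gauss K eta) (radial K v ^+ n).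

End euclidean.

Arguments sphere {R n}.
Arguments sphere_measure {R n}.

(* Main.v *)
(* For 0 < |p| small, write X = (1-p)/2 int_K |u.y|^-p dy, so that the radial
   function of I_p K is rho = X^(1/p). A slab {|u.y| <= e} meets K, and the
   sphere, in a set of measure O(e) uniformly in u, whence
   int | |u.y|^-p - 1 | = O(p) uniformly in u on either of them. Since V(K) = 2
   this gives X = 1 + O(p): rho is bounded away from 0 and infinity, although
   its limit is never computed, and rho^-p = X^-1 = 1 + O(p). Hence
   T_{-p} rho^(n-p) (v) = int rho^n + O(p) = n V(I_p K) + O(p) uniformly in v,
   the last equality being integration in polar coordinates. The integrand of
   the normalised p-affine dual curvature measure thus converges uniformly on
   the sphere to that of the cone-volume measure. Uniform convergence is enough
   to pass to the limit without knowing that the reverse radial Gauss image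
   is measurable. *)
Require Import Defs.
From mathcomp Require Import all_boot all_order all_algebra.
From mathcomp Require Import all_classical all_reals all_analysis.
From mathcomp Require Import measurable_realfun ring lra.
Import Order.TTheory GRing.Theory Num.Theory.
Import numFieldNormedType.Exports.
Local Open Scope classical_set_scope.
Local Open Scope ring_scope.
Set Implicit Arguments.
Unset Strict Implicit.
Unset Printing Implicit Defensive.

(** * Integration over non-measurable sets *)

Import HBNNSimple.

(** Every error term comes from one bound, linear in [p] and valid for both signs of [p]: for
    [s > 0] and [|p| <= 1/4], [|s ^ (- p) - 1|] is at most [4 |p| (sqrt s + 1 / sqrt s)]. Its
    singularity [s ^ (-1/2)] does not depend on [p] and is integrable as soon as the sets where
    [s <= e] have measure [O(e)]. For slabs the constant is independent of the direction because a
    unit vector has a coordinate of absolute value at least [1/n]. The weight [rho ^ (n - p)] inside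
    the cosine transform changes with [p], so the estimate is stated for a weight of which only a
    bound is known. The spherical measure is defined by volumes of cones, so integration in polar
    coordinates has to be proved: cones scale by the power [n], and a general radial function is cut
    into shells on which it is nearly constant. *)

Section nonmeasurable_integral.
Context d (T : measurableType d) (R : realType) (mu : {measure set T -> \bar R}).
Local Open Scope ereal_scope.

(* No measurability is needed: a simple function below [f] is cut down to one below [g]. *)
Lemma ge0_le_integral_affine (D S : set T) (f g : T -> R) (c e : R) :
  measurable S -> D `<=` S -> (0 < c)%R -> (0 <= e)%R ->
  (forall x, D x -> 0 <= f x)%R -> (forall x, D x -> 0 <= g x)%R ->
  (forall x, D x -> f x <= c * g x + e)%R ->
  \int[mu]_(x in D) (f x)%:E <= c%:E * \int[mu]_(x in D) (g x)%:E + e%:E * mu S.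
Proof.
move=> mS DS c0 e0 f0 g0 fg.
rewrite ge0_integralE//; apply: ge_ereal_sup => _ [/= h hf <-].
rewrite -integralT_nnsfun.
have hD x : ~ D x -> (h x <= 0)%R.
  by move=> Dx; have := hf x; rewrite patchE memNset.
have hfD x : D x -> (h x <= f x)%R.
  by move=> Dx; have := hf x; rewrite patchE mem_set.
(* Off [D] the function [h] is at most 0, so [k] vanishes there. A simple function below [k] is
   therefore below [g] extended by zero. The error [e] is charged to [S], whose measure is
   meaningful. *)
pose k x := Num.max (c^-1 * (h x - e))%R 0%R.
have mk : measurable_fun setT k.
  apply: measurable_maxr => //; apply: measurable_funM => //.
  exact: measurable_funB.
have k0 x : (0 <= k x)%R by rewrite le_max lexx orbT.
have kg : \int[mu]_x (k x)%:E <= \int[mu]_(x in D) (g x)%:E.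
  rewrite ge0_integralE//; last by move=> x _; rewrite lee_fin.
  rewrite [leRHS]ge0_integralE//; apply: le_ereal_sup => _ [/= h' h'k <-].
  exists h' => // x; apply: (le_trans (h'k x)).
  rewrite !patchE in_setT; case: ifPn => [|]; rewrite ?inE ?notin_setE => Dx; rewrite lee_fin.
    rewrite /k ge_max g0// andbT ler_pdivrMl// lerBlDr.
    by apply: (le_trans (hfD _ Dx)); exact: fg.
  rewrite ge_max lexx andbT pmulr_rle0 ?invr_gt0// subr_le0.
  exact: le_trans (hD _ Dx) e0.
apply: (@le_trans _ _ (\int[mu]_x ((c * k x)%:E + (e * \1_S x)%:E))).
  apply: ge0_le_integral => //.
  - by move=> x _; rewrite lee_fin.
  - by apply/measurable_EFinP.
  - apply: emeasurable_funD; apply/measurable_EFinP; exact: measurable_funM.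
  move=> x _; rewrite -EFinD lee_fin.
  have ck : (h x - e <= c * k x)%R.
    by rewrite -ler_pdivrMl// /k le_max lexx.
  have ck0 : (0 <= c * k x)%R by rewrite mulr_ge0// ltW.
  rewrite indicE; case: (boolP (x \in S)); rewrite ?inE ?notin_setE => Sx.
    by rewrite mulr1 -lerBlDr.
  rewrite mulr0 addr0; apply: le_trans ck0; apply: hD; exact: contra_not (DS x) Sx.
rewrite ge0_integralD//; last 4 first.
- by move=> x _; rewrite lee_fin mulr_ge0// ltW.
- by apply/measurable_EFinP; exact: measurable_funM.
- by move=> x _; rewrite lee_fin mulr_ge0.
- by apply/measurable_EFinP; exact: measurable_funM.
apply: leeD.
  under eq_integral do rewrite EFinM.
  rewrite ge0_integralZl_EFin//; last 3 first.
  - by move=> x _; rewrite lee_fin.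
  - exact/measurable_EFinP.
  - exact: ltW.
  by apply: lee_wpmul2l => //; rewrite lee_fin ltW.
under eq_integral do rewrite EFinM.
rewrite ge0_integralZl_EFin//; last exact/measurable_EFinP.
by rewrite integral_indic// setIT.
Qed.

(** The common bound [M] and the finite measure of [S] make both integrals finite, so that [fine]
    does not turn an infinite value into 0. Applied with [f] and [g] exchanged as well, it replaces
    an estimate of the integral of a difference. *)
Lemma ge0_le_Rintegral_affine (D S : set T) (f g : T -> R) (c e M : R) :
  measurable S -> mu S < +oo -> D `<=` S -> (0 < c)%R -> (0 <= e)%R ->
  (forall x, D x -> 0 <= f x <= M)%R -> (forall x, D x -> 0 <= g x <= M)%R ->
  (forall x, D x -> f x <= c * g x + e)%R ->
  (\int[mu]_(x in D) f x <= c * \int[mu]_(x in D) g x + e * fine (mu S))%R.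
Proof.
move=> mS Soo DS c0 e0 f0 g0 fg.
have fin (u : T -> R) : (forall x, D x -> 0 <= u x <= M)%R ->
    \int[mu]_(x in D) (u x)%:E \is a fin_num.
  move=> uM; rewrite ge0_fin_numE; last first.
    by apply: integral_ge0 => x Dx; rewrite lee_fin; have /andP[] := uM _ Dx.
  have [M0|M0] := leP 0%R M; last first.
    rewrite (_ : D = set0) ?integral_set0//; apply/seteqP; split=> x //= /uM /andP[u0 uM'].
    by have := le_lt_trans (le_trans u0 uM') M0; rewrite ltxx.
  have /le_lt_trans : \int[mu]_(x in D) (u x)%:E <=
      1%:E * \int[mu]_(x in D) (cst 0%R x)%:E + M%:E * mu S.
    apply: ge0_le_integral_affine => // x Dx; first by case/andP: (uM _ Dx).
    by rewrite mulr0 add0r; case/andP: (uM _ Dx).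
  apply; rewrite integral0 mule0 add0e lte_mul_pinfty//.
have mfin : mu S \is a fin_num by rewrite ge0_fin_numE.
rewrite -lee_fin EFinD !EFinM /Rintegral !fineK ?fin//.
by apply: ge0_le_integral_affine => // x Dx; [case/andP: (f0 _ Dx)|case/andP: (g0 _ Dx)].
Qed.
End nonmeasurable_integral.

(** * Estimates of [s ^ (- p) - 1] *)

Section elementary.
Context (R : realType).
Implicit Types (x p s : R).

Lemma norm_expR_sub1 x : `|expR x - 1| <= `|x| * expR `|x|.
Proof.
have [x0|x0] := leP 0 x.
  rewrite ger0_norm ?(ger0_norm x0)//; last by rewrite subr_ge0 -expR0 ler_expR.
  have := expR_ge1Dx (- x); have := expR_gt0 x; have := expRxMexpNx_1 x.
  by nra.
rewrite ler0_norm ?(ltr0_norm x0)//; last by rewrite subr_le0 -expR0 ler_expR ltW.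
have := expR_ge1Dx x; have : 1 <= expR (- x) by rewrite -expR0 ler_expR oppr_ge0 ltW.
by nra.
Qed.

(** With [a = |ln s|] the left side is at most [|p| a e^(|p| a)]. Both [a <= 4 e^(a/4)] and
    [|p| <= 1/4] are spent to reach [4 |p| e^(a/2)], and [e^(a/2)] is the larger of [sqrt s] and its
    inverse. *)
Lemma norm_powR_sub1 p s : `|p| <= 4^-1 -> 0 < s ->
  `|s `^ (- p) - 1| <= `|p| * (4 * (Num.sqrt s + (Num.sqrt s)^-1)).
Proof.
move=> p4 s0; rewrite {1}/powR gt_eqF// mulNr.
have sE : Num.sqrt s = expR (ln s / 2).
  by rewrite -powR12_sqrt ?ltW// /powR gt_eqF// mulrC.
apply: (le_trans (norm_expR_sub1 _)); rewrite normrN normrM -mulrA ler_wpM2l//.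
set a := `|ln s|; have a0 : 0 <= a by exact: normr_ge0.
have h1 : a <= 4 * expR (a / 4).
  by have := expR_ge1Dx (a / 4); lra.
have h2 : expR (`|p| * a) <= expR (a / 4).
  by rewrite ler_expR mulrC ler_wpM2l.
have h3 : expR (a / 2) <= Num.sqrt s + (Num.sqrt s)^-1.
  rewrite sE -expRN /a; have [?|?] := ger0P (ln s).
    by rewrite ler_wpDr ?expR_ge0//.
  by rewrite mulNr ler_wpDl ?expR_ge0//.
apply: (@le_trans _ _ (4 * expR (a / 4) * expR (a / 4))).
  by apply: ler_pM; rewrite ?mulr_ge0 ?expR_ge0//.
rewrite -mulrA -expRD ler_pM2l//; apply: le_trans h3.
by rewrite ler_expR; lra.
Qed.

(** Meant for [y = 1 / sqrt (f x)]: the lower bound places [x] in the level set [f <= 4^-k], and the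
    upper bound says that the weight given to this level dominates [y]. The alternative [k = 0]
    takes care of the [y] below 1. *)
Lemma dyadic_bound (y : R) : exists k, y <= 2 ^+ k.+1 /\ (k = 0%N \/ 2 ^+ k <= y).
Proof.
have ex : exists k, y <= 2 ^+ k.+1.
  exists (Num.trunc y); apply: (le_trans (ltW (truncnS_gt y))) => /=.
  by rewrite -natrX ler_nat ltnW// ltn_expl.
case: (ex_minnP ex) => -[|k] hk kmin; [exists 0%N; split => //; by left|].
exists k.+1; split => //; right; rewrite leNgt; apply/negP => /ltW /kmin.
by rewrite ltnn.
Qed.

End elementary.

Section small_value_estimate.
Context d (T : measurableType d) (R : realType) (mu : {measure set T -> \bar R}).
Local Open Scope ereal_scope.

(* The values of [f] are split at the powers of 1/4: since the set [f <= 4^-k]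
   has measure [<= C 4^-k], the function [f ^ (-1/2)] has integral at most
   [sum_k 2^(k+1) C 4^-k = 4 C]. *)
Lemma integral_powR_sub1_le (D : set T) (f : T -> R) (C M p : R) :
  measurable D -> measurable_fun D f ->
  (forall x, D x -> 0 <= f x <= M)%R ->
  (0 <= C)%R -> mu D <= C%:E ->
  (forall e, (0 < e)%R -> mu (D `&` [set x | (f x <= e)%R]) <= (C * e)%:E) ->
  (`|p| <= 4^-1)%R ->
  \int[mu]_(x in D) (`|f x `^ (- p) - 1|%R)%:E <=
    (`|p| * (4 * ((Num.sqrt M + 4) * C)))%:E.
Proof.
move=> mD mf f0M C0 muD hC p4.
have [->|p0] := eqVneq p 0%R.
  rewrite normr0 mul0r integral0_eq// => x _.
  by rewrite oppr0 powRr0 subrr normr0.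
(* Level 0 is all of [D], to match the alternative [k = 0] of [dyadic_bound]; its measure is
   controlled by [muD] instead of [hC]. *)
pose A k := if k is 0%N then D else D `&` [set x | (f x <= 4^-1 ^+ k)%R].
have mA k : measurable (A k).
  case: k => [//|k] /=.
  rewrite (_ : [set x | _] = f @^-1` `]-oo, (4^-1 ^+ k.+1)%R]%classic); first exact: mf.
  by apply/seteqP; split=> x /=; rewrite in_itv.
have muA k : mu (A k) <= (C * 4^-1 ^+ k)%:E.
  case: k => [|k]; first by rewrite expr0 mulr1.
  by apply: hC; rewrite exprn_gt0// invr_gt0.
pose G k x := (2 ^+ k.+1 * \1_(A k) x)%:E : \bar R.
have G0 k x : 0 <= G k x by rewrite lee_fin mulr_ge0// exprn_ge0.
have mG k : measurable_fun D (G k).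
  by apply/measurable_EFinP; apply: measurable_funM => //; apply: measurable_funTS.
have intG k : \int[mu]_(x in D) G k x <= (C * geometric 2 2^-1 k)%:E.
  rewrite /G; under eq_integral do rewrite EFinM.
  rewrite ge0_integralZl_EFin//; last by apply/measurable_EFinP; apply: measurable_funTS.
  rewrite integral_indic//.
  apply: (@le_trans _ _ ((2 ^+ k.+1)%:E * (C * 4^-1 ^+ k)%:E)).
    apply: lee_wpmul2l; first by rewrite lee_fin exprn_ge0.
    apply: le_trans (muA k); apply: le_measure; rewrite ?inE//; exact: measurableI.
  rewrite -EFinM lee_fin /geometric /= mulrCA ler_wpM2l// exprS -mulrA ler_wpM2l//.
  by rewrite -exprMn (_ : 2 * 4^-1 = 2^-1 :> R)%R//; lra.
have Gs x k : (2 ^+ k.+1)%:E * (\1_(A k) x)%:E <= \sum_(i <oo) G i x.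
  apply: le_trans (nneseries_lim_ge k.+1 _) => //.
  by rewrite big_nat_recr//= -EFinM leeDr// sume_ge0.
have key x : D x -> (`|f x `^ (- p) - 1|%R)%:E <=
    (`|p| * 4)%:E * ((Num.sqrt M)%:E + \sum_(i <oo) G i x).
  move=> Dx; have /andP[f0 fM] := f0M x Dx.
  (* At a zero of [f] the convention [powR 0 (- p) = 0] makes the left side 1, which is not small
     with [p]. Such a point lies in every [A k], so a term of the series with [2 ^ (k + 1)] at least
     [1 / |p|] absorbs it. *)
  have [fx0|fx0] := eqVneq (f x) 0%R.
    rewrite fx0 powR0 ?oppr_eq0// sub0r normrN1.
    pose k := Num.trunc (`|p|^-1).
    have h : (1 <= `|p| * 4 * 2 ^+ k.+1)%R.
      have : (`|p|^-1 <= 2 ^+ k.+1)%R.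
        apply: (le_trans (ltW (truncnS_gt _))).
        by rewrite -natrX ler_nat ltnW// ltn_expl.
      move=> h; have : (1 <= `|p| * 2 ^+ k.+1)%R.
        by rewrite -ler_pdivrMl ?normr_gt0// mulr1.
      by lra.
    apply: (@le_trans _ _ ((`|p| * 4)%:E * (2 ^+ k.+1)%:E)).
      by rewrite -EFinM lee_fin.
    apply: lee_wpmul2l; first by rewrite lee_fin mulr_ge0.
    apply: le_trans (_ : _ <= \sum_(i <oo) G i x) _; last first.
      by rewrite leeDr// lee_fin sqrtr_ge0.
    apply: le_trans (Gs x k); rewrite indicE mem_set ?mule1//.
    by rewrite /A; case: (k) => // k'; split=> //=; rewrite fx0 exprn_ge0// invr_ge0.
  have {fx0}f0 : (0 < f x)%R by rewrite lt_def fx0.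
  apply: (@le_trans _ _ (`|p| * (4 * (Num.sqrt (f x) + (Num.sqrt (f x))^-1)))%:E).
    by rewrite lee_fin norm_powR_sub1.
  rewrite mulrA EFinM; apply: lee_wpmul2l; first by rewrite lee_fin mulr_ge0.
  rewrite EFinD; apply: leeD; first by rewrite lee_fin ler_sqrt// ltW// (lt_le_trans f0).
  have [k [yk k0]] := dyadic_bound ((Num.sqrt (f x))^-1)%R.
  apply: le_trans (Gs x k); rewrite -EFinM lee_fin indicE mem_set ?mulr1//.
  case: k k0 yk => [//|k] [//|k0] _; split=> //=.
  have s0 : (0 < Num.sqrt (f x))%R by rewrite sqrtr_gt0.
  have : (Num.sqrt (f x) <= 2^-1 ^+ k.+1)%R.
    by rewrite exprVn -[leLHS]invrK lef_pV2// posrE ?invr_gt0// exprn_gt0.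
  move=> h; rewrite -[leLHS]sqr_sqrtr ?(ltW f0)//.
  rewrite (_ : 4^-1 = 2^-1 ^+ 2 :> R)%R; last by rewrite exprVn; congr (_^-1)%R; rewrite -natrX.
  rewrite (exprAC _ 2).
  by rewrite ler_pXn2r// nnegrE ?(ltW s0)// exprn_ge0// invr_ge0.
have ms : measurable_fun D (fun x => \sum_(i <oo) G i x).
  by apply: ge0_emeasurable_sum => // k x Dx _; exact: G0.
apply: (@le_trans _ _ (\int[mu]_(x in D)
    ((`|p| * 4)%:E * ((Num.sqrt M)%:E + \sum_(i <oo) G i x)))).
  apply: ge0_le_integral => //.
  - apply/measurable_EFinP; apply: measurableT_comp => //.
    apply: measurable_funB => //.
    exact: (measurableT_comp (measurable_powR (- p)) mf).
  - apply: measurable_funeM; exact: emeasurable_funD.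
have s0 x : 0 <= \sum_(i <oo) G i x by apply: nneseries_ge0.
rewrite ge0_integralZl_EFin//; last 2 first.
- by move=> x _; rewrite adde_ge0// lee_fin sqrtr_ge0.
- exact: emeasurable_funD.
rewrite (mulrA `|p|%R) [in leRHS]EFinM; apply: lee_wpmul2l; first by rewrite lee_fin mulr_ge0.
rewrite ge0_integralD//.
rewrite mulrDl EFinD; apply: leeD.
  by rewrite integral_cst// EFinM; apply: lee_wpmul2l; rewrite // lee_fin sqrtr_ge0.
rewrite integral_nneseries//.
apply: (@le_trans _ _ (\sum_(i <oo) (C * geometric 2 2^-1 i)%:E)).
  by apply: lee_nneseries => // i _ _; apply: integral_ge0 => x _.
under eq_eseriesr do rewrite EFinM.
rewrite nneseriesZl; last first.
  by move=> i _; rewrite lee_fin /= mulr_ge0// exprn_ge0// invr_ge0.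
rewrite mulrC EFinM; apply: lee_wpmul2l => //.
have r1 : (`|2^-1 : R| < 1)%R by rewrite ger0_norm//; lra.
have cv : (series (geometric 2 2^-1) x @[x --> \oo] --> (4 : R))%R.
  have := @cvg_geometric_series R 2%R (2^-1)%R r1.
  by rewrite (_ : 1 - 2^-1 = 2^-1 :> R)%R ?invrK -?natrM//; lra.
rewrite (_ : (fun n => _) = EFin \o series (geometric 2 2^-1)%R); last first.
  by apply/funext => n /=; rewrite /series/= sumEFin.
rewrite (EFin_lim (is_cvg_geometric_series r1)).
by rewrite (cvg_lim _ cv).
Qed.

End small_value_estimate.

(** * Lebesgue measure of boxes and slabs *)

Section lebesgue_rV_geometry.
Context (R : realType).
Local Open Scope ereal_scope.
Implicit Types n : nat.

Lemma measurable_linear_form n (v : 'rV[R]_n) :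
  measurable_fun [set: 'rV[R]_n] (dot v).
Proof.
apply: measurable_sum => i; apply: measurable_funM => //.
exact: measurable_coord_rV.
Qed.

Definition box n (r : R) : set 'rV[R]_n :=
  [set x | forall i, (x 0%R i) \in `[- r, r]%R].

Lemma measurable_box n r : measurable (@box n r).
Proof.
rewrite (_ : box r = \bigcap_(i in [set: 'I_n])
    ((fun x : 'rV[R]_n => x 0%R i) @^-1` `[(- r)%R, r]%classic)).
  apply: fin_bigcap_measurable => [|i _]; first exact: finite_finset.
  by rewrite -[X in measurable X]setTI; apply: measurable_coord_rV.
by apply/seteqP; split=> x /= xr i; [move=> _|]; exact: xr.
Qed.

Lemma lebesgue_measure_symmetric_itv (r : R) : (0 <= r)%R ->
  lebesgue_measure (`[(- r)%R, r]%classic : set R) = (r *+ 2)%:E.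
Proof.
move=> r0; rewrite lebesgue_measure_itv/= lte_fin.
case: ltP => h; first by rewrite -EFinB opprK mulr2n.
by congr EFin; apply/eqP; rewrite eq_sym mulr2n; apply/eqP; lra.
Qed.

Lemma lebesgue_rV_boxE n (r : R) : (0 <= r)%R ->
  lebesgue_rV R n (@box n r) = ((r *+ 2) ^+ n)%:E.
Proof.
move=> r0; have E := @lebesgue_rV_box R n (fun=> `[(- r)%R, r]%classic).
rewrite [LHS]E//; clear E.
under eq_bigr do rewrite lebesgue_measure_symmetric_itv//.
by rewrite prodEFin prodr_const card_ord.
Qed.

Lemma lebesgue_rVS n (A : set 'rV[R]_n.+1) :
  lebesgue_rV R n.+1 A =
  \int[lebesgue_measure]_t lebesgue_rV R n [set y | A (cons_rV (t, y))].
Proof.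
rewrite /= /lebesgue_rV_step /pushforward /= /product_measure1.
by apply: eq_integral => t _ /=; congr (lebesgue_rV R n _);
  apply/seteqP; split=> y; rewrite /xsection/= in_setE.
Qed.

(** Lines in the first coordinate are measured first here, the opposite of the order in the
    definition. The two product measures agree on rectangles, hence on all measurable sets. *)
Lemma lebesgue_rVSr n (A : set 'rV[R]_n.+1) : measurable A ->
  lebesgue_rV R n.+1 A =
  \int[lebesgue_rV R n]_y lebesgue_measure [set t : R | A (cons_rV (t, y))].
Proof.
move=> mA; have mA' : measurable (@cons_rV R n @^-1` A).
  by rewrite -[X in measurable X]setTI; apply: measurable_cons_rV.
transitivity ((lebesgue_measure \x^ lebesgue_rV R n) (@cons_rV R n @^-1` A)).
  rewrite /= /lebesgue_rV_step /pushforward.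
  apply: product_measure_unique => // B1 B2 mB1 mB2.
  exact: product_measure2E.
rewrite /= /product_measure2.
by apply: eq_integral => t _ /=; congr (lebesgue_measure _);
  apply/seteqP; split=> y; rewrite /ysection/= in_setE.
Qed.

Lemma dot_cons n (v : 'rV[R]_n.+1) t y :
  dot v (cons_rV (t, y)) =
  (v 0 ord0 * t + dot (\row_j v 0 (lift ord0 j)) y)%R.
Proof.
rewrite /dot big_ord_recl !mxE unlift_none/=; congr (_ + _)%R.
by apply: eq_bigr => i _; rewrite !mxE liftK.
Qed.

Lemma box_cons n r t (y : 'rV[R]_n) :
  box r (cons_rV (t, y)) <-> t \in `[- r, r]%R /\ box r y.
Proof.
split=> [h|[tr yr] i].
  split=> [|i]; first by have := h ord0; rewrite mxE unlift_none.
  by have := h (lift ord0 i); rewrite mxE liftK.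
by rewrite mxE; case: unliftP => [j|] _ //=; exact: yr.
Qed.

(** The offset [c] serves the induction on the dimension: fixing the first coordinate at [t] adds
    [v 0 ord0 * t] to it. *)
Definition slab n (v : 'rV[R]_n) (c r e : R) : set 'rV[R]_n :=
  box r `&` [set x | `|c + dot v x| <= e]%R.

Lemma measurable_slab n (v : 'rV[R]_n) c r e : measurable (slab v c r e).
Proof.
apply: measurableI; first exact: measurable_box.
rewrite (_ : [set x | _] = (fun x => `|c + dot v x|%R) @^-1` `]-oo, e]%classic).
  rewrite -[X in measurable X]setTI.
  have mf : measurable_fun setT (fun x => `|c + dot v x|%R).
    apply: measurableT_comp => //; apply: measurable_funD => //.
    exact: measurable_linear_form.
  exact: mf.
by apply/seteqP; split=> x /=; rewrite in_itv.
Qed.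

Lemma lebesgue_interval_le (a b e : R) : (0 <= e)%R -> (a != 0)%R ->
  lebesgue_measure [set t : R | (`|b + a * t| <= e)%R] <= (e *+ 2 / `|a|)%:E.
Proof.
move=> e0 a0; have a1 : (0 < `|a|)%R by rewrite normr_gt0.
rewrite (_ : [set t | _] = `[(- b / a - e / `|a|)%R, (- b / a + e / `|a|)%R]%classic).
  rewrite lebesgue_measure_itv/= lte_fin; case: ifPn => _.
    by rewrite -EFinB lee_fin mulr2n; lra.
  by rewrite lee_fin divr_ge0// mulrn_wge0.
apply/seteqP; split=> t /=; rewrite in_itv/= -ler_distlC.
  rewrite (_ : - b / a - t = - ((b + a * t) / a))%R; last by field.
  by rewrite normrN normrM normfV => h; rewrite ler_wpM2r// invr_ge0.
rewrite (_ : - b / a - t = - ((b + a * t) / a))%R; last by field.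
by rewrite normrN normrM normfV ler_pM2r// invr_gt0.
Qed.

(** In the direction of coordinate [i] the slab has slices of length at most [2 e / |v_i|], and the
    other [n - 1] coordinates range over a cube of side [2 r]. If [i] is not the first coordinate,
    the first one is integrated out and the induction hypothesis is used with a shifted offset. *)
Lemma lebesgue_rV_slab n (v : 'rV[R]_n) (c r e : R) (i : 'I_n) :
  (0 <= r)%R -> (0 <= e)%R -> v 0%R i != 0%R ->
  lebesgue_rV R n (slab v c r e) <=
    ((r *+ 2) ^+ n.-1 * (e *+ 2 / `|v 0 i|))%:E.
Proof.
move=> r0 e0; elim: n v c i => [|n IHn] v c i; first by case: i.
have mS := measurable_slab v c r e.
pose v' : 'rV[R]_n := \row_j v 0%R (lift ord0 j).
case: (unliftP ord0 i) => [j|] -> vi0.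
  have n0 : (0 < n)%N := leq_ltn_trans (leq0n j) (ltn_ord j).
  rewrite lebesgue_rVS /=.
  apply: (@le_trans _ _ (\int[lebesgue_measure]_t
      (((r *+ 2) ^+ n.-1 * (e *+ 2 / `|v 0 (lift ord0 j)|)) *
        \1_(`[(- r)%R, r]%classic) t)%:E)).
    apply: ge0_le_integral => //.
    - have mS' : measurable (@cons_rV R n @^-1` slab v c r e).
        by rewrite -[X in measurable X]setTI; apply: measurable_cons_rV.
      have := measurable_fun_xsection (lebesgue_rV R n) mS'.
      apply: eq_measurable_fun => t _ /=; congr (lebesgue_rV R n _).
      by apply/seteqP; split=> y; rewrite /xsection/= in_setE.
    - by apply/measurable_EFinP; apply: measurable_funM.
    move=> t _; rewrite indicE; case: (boolP (t \in _)); rewrite ?inE ?notin_setE => tr.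
      rewrite mulr1 (_ : [set y | _] = slab v' (c + v 0 ord0 * t)%R r e).
        by have := IHn v' (c + v 0 ord0 * t)%R j; rewrite mxE; apply.
      apply/seteqP; split=> y /=.
        by move=> [/box_cons[_ yr] /=]; rewrite dot_cons addrA; split.
      move=> [yr /= h]; split; first by apply/box_cons; split.
      by rewrite /= dot_cons addrA.
    rewrite mulr0 (_ : [set y | _] = set0) ?measure0//.
    by apply/seteqP; split=> y //= [/box_cons[]].
  have b0 : (0 <= (r *+ 2) ^+ n.-1 * (e *+ 2 / `|v 0 (lift ord0 j)|))%R.
    by rewrite mulr_ge0 ?exprn_ge0 ?divr_ge0 ?mulrn_wge0.
  under eq_integral do rewrite EFinM.
  rewrite ge0_integralZl_EFin//; last exact/measurable_EFinP.
  rewrite integral_indic// setIT [X in _ * X](lebesgue_measure_symmetric_itv r0).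
  have -> : ((r *+ 2) ^+ n = (r *+ 2) ^+ n.-1 * (r *+ 2))%R.
    by rewrite -exprSr prednK.
  by rewrite -EFinM lee_fin mulrAC.
rewrite lebesgue_rVSr//.
apply: (@le_trans _ _ (\int[lebesgue_rV R n]_y
      ((e *+ 2 / `|v 0 ord0|) * \1_(box r) y)%:E)).
  apply: ge0_le_integral => //.
  - have mS' : measurable (@cons_rV R n @^-1` slab v c r e).
      by rewrite -[X in measurable X]setTI; apply: measurable_cons_rV.
    have := measurable_fun_ysection lebesgue_measure mS'.
    apply: eq_measurable_fun => t _ /=; congr (lebesgue_measure _).
    by apply/seteqP; split=> y; rewrite /ysection/= in_setE.
  - apply/measurable_EFinP; apply: measurable_funM => //.
    apply: measurable_indic; exact: measurable_box.
  move=> y _; rewrite indicE; case: (boolP (y \in _)); rewrite ?inE ?notin_setE => yr.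
    rewrite mulr1; apply: le_trans (lebesgue_interval_le (c + dot v' y)%R e0 vi0).
    apply: le_measure; rewrite ?inE.
    - have mS' : measurable (@cons_rV R n @^-1` slab v c r e).
        by rewrite -[X in measurable X]setTI; apply: measurable_cons_rV.
      have := measurable_ysection y mS'.
      by congr (measurable _); apply/seteqP; split=> t; rewrite /ysection/= in_setE.
    - rewrite (_ : [set t | _] = (fun t => `|c + dot v' y + v 0 ord0 * t|%R) @^-1` `]-oo, e]%classic).
        rewrite -[X in measurable X]setTI.
        have mf : measurable_fun setT (fun t : R => `|c + dot v' y + v 0 ord0 * t|%R).
          apply: measurableT_comp => //; apply: measurable_funD => //.
        exact: mf.
      by apply/seteqP; split=> x /=; rewrite in_itv.
    by move=> t /= [_ /=]; rewrite dot_cons addrA (addrAC c).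
  rewrite mulr0 (_ : [set t | _] = set0) ?measure0//.
  by apply/seteqP; split=> t //= [/box_cons[]].
have b0 : (0 <= (e *+ 2 / `|v 0 ord0|))%R by rewrite divr_ge0 ?mulrn_wge0.
have mB := @measurable_box n r.
under eq_integral do rewrite EFinM.
rewrite ge0_integralZl_EFin//; last by apply/measurable_EFinP; exact: measurable_indic.
by rewrite integral_indic// setIT [X in _ * X](lebesgue_rV_boxE n r0) -EFinM mulrC.
Qed.

End lebesgue_rV_geometry.

(** * Homogeneity and the spherical measure *)

Section scaling.
Context (R : realType).
Local Open Scope ereal_scope.
Implicit Types n : nat.

Lemma measurable_scale_rV n (s : R) :
  measurable_fun [set: 'rV[R]_n] (fun x => s *: x : 'rV[R]_n)%R.
Proof.
apply/measurable_rVP => i; under eq_fun do rewrite mxE.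
by apply: measurable_funM => //; exact: measurable_coord_rV.
Qed.

(** Uniqueness of Lebesgue measure: [s] times the pushforward under multiplication by [s] gives
    half-open intervals their length. *)
Lemma lebesgue_measure_scale (s : R) (A : set R) : (0 < s)%R -> measurable A ->
  lebesgue_measure ((fun x => s * x)%R @^-1` A) = s^-1%:E * lebesgue_measure A.
Proof.
move=> s0 mA.
have mf : measurable_fun [set: measurableTypeR R]
    ((fun x => s * x)%R : measurableTypeR R -> measurableTypeR R).
  exact: mulrl_measurable.
have si0 : (0 <= s)%R by exact: ltW.
pose pf : {measure set (measurableTypeR R) -> \bar R} :=
  measure_function_pushforward__canonical__measure_function_Measure lebesgue_measure mf.
pose m := mscale (NngNum si0) pf.
have : lebesgue_measure A = m A.
  apply: lebesgue_measure_unique => //= _ [[a b]] _ <-.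
  rewrite /m /mscale /pf /= /pushforward.
  rewrite (_ : _ @^-1` _ = `]a / s, b / s]%classic)%R; last first.
    by apply/seteqP; split=> x /=; rewrite !in_itv/= ltr_pdivrMr// ler_pdivlMr// mulrC.
  rewrite !lebesgue_measure_itv/= !lte_fin ltr_pM2r ?invr_gt0//.
  by case: ifPn => _; rewrite ?mule0// -!EFinB -EFinM; congr EFin; field; rewrite gt_eqF.
rewrite /m /mscale /pf /= /pushforward => ->.
by rewrite muleA -EFinM mulVf ?gt_eqF// mul1e.
Qed.

(** This passes from cones of radius 1, which define the spherical measure, to cones of any radius.
    As in dimension one, the rescaled pushforward is identified by its values, now on rectangles. *)
Lemma lebesgue_rV_scale n (s : R) (A : set 'rV[R]_n) : (0 < s)%R -> measurable A ->
  lebesgue_rV R n ((fun x => s *: x)%R @^-1` A) = (s ^- n)%:E * lebesgue_rV R n A.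
Proof.
move=> s0; elim: n A => [|n IHn] A mA.
  rewrite expr0 invr1 mul1e /= !diracE; congr (_%:R%:E); congr nat_of_bool.
  apply/idP/idP; rewrite !inE/= => A0.
    by rewrite (_ : 0%R = s *: 0)%R// scaler0.
  by rewrite scaler0.
have mS := @measurable_scale_rV n.+1 s.
have s1 : (0 <= s ^+ n.+1)%R by rewrite exprn_ge0// ltW.
have mcA (B : set 'rV[R]_n.+1) : measurable B -> measurable (@cons_rV R n @^-1` B).
  by move=> mB; rewrite -[X in measurable X]setTI; apply: measurable_cons_rV.
pose S := measurableTypeR R.
pose h (z : S * 'rV[R]_n) : S * 'rV[R]_n := (s * z.1, s *: z.2)%R.
have mh : measurable_fun setT h.
  apply: measurable_fun_pair => /=.
    by apply: (measurableT_comp (mulrl_measurable s)); exact: measurable_fst.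
  by apply: (measurableT_comp (@measurable_scale_rV n s)); exact: measurable_snd.
pose pf : {measure set (S * 'rV[R]_n) -> \bar R} :=
  measure_function_pushforward__canonical__measure_function_Measure
    (@lebesgue_measure R \x lebesgue_rV R n) mh.
pose m : {measure set (S * 'rV[R]_n) -> \bar R} := mscale (NngNum s1) pf.
have E (X : set (S * 'rV[R]_n)) : measurable X ->
    (@lebesgue_measure R \x lebesgue_rV R n) X = m X.
  move: X; apply: product_measure_unique => B1 B2 mB1 mB2.
  transitivity ((s ^+ n.+1)%:E * (lebesgue_measure \x lebesgue_rV R n) (h @^-1` (B1 `*` B2))) => //.
  rewrite (_ : _ @^-1` _ = ((fun x => s * x)%R @^-1` B1) `*` ((fun x => s *: x)%R @^-1` B2)).
    rewrite product_measure1E//; last 2 first.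
    - by rewrite -[X in measurable X]setTI; exact: mulrl_measurable.
    - by rewrite -[X in measurable X]setTI; exact: measurable_scale_rV.
    rewrite [X in _ * (X * _)](lebesgue_measure_scale s0 mB1) [X in _ * (_ * X)](IHn _ mB2).
    have cancel (a b : \bar R) :
        (s ^+ n.+1)%:E * (s^-1%:E * a * ((s ^- n)%:E * b)) = a * b.
      rewrite muleACA -EFinM [LHS]muleA -EFinM [X in X%:E](_ : _ = 1%R) ?mul1e//.
      by rewrite exprS; field; rewrite ?expf_neq0 ?gt_eqF.
    exact: cancel.
  by apply/seteqP; split=> z.
transitivity ((lebesgue_measure \x lebesgue_rV R n) (@cons_rV R n @^-1` ((fun x => s *: x)%R @^-1` A))) => //.
transitivity ((s ^- n.+1)%:E * (lebesgue_measure \x lebesgue_rV R n) (@cons_rV R n @^-1` A)) => //.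
rewrite (E _ (mcA _ mA)).
transitivity ((s ^- n.+1)%:E * ((s ^+ n.+1)%:E * (lebesgue_measure \x lebesgue_rV R n)
  (h @^-1` (@cons_rV R n @^-1` A)))) => //.
rewrite muleA -EFinM mulVf ?mul1e; last first.
  by rewrite expf_neq0// gt_eqF.
congr (product_measure1 _ _ _); apply/seteqP.
suff e z : (s *: @cons_rV R n z = cons_rV (s * z.1, s *: z.2))%R by split=> z /=; rewrite e.
by apply/rowP => i; rewrite !mxE; case: unliftP => [j|] _ //=; rewrite mxE.
Qed.

End scaling.

(** * The spherical measure and sets in polar coordinates *)

Section sphere_measure_theory.
Context (R : realType) (n : nat).
Local Open Scope ereal_scope.
Implicit Types (x u v : 'rV[R]_n) (A : set 'rV[R]_n).

Lemma enorm_ge0 x : (0 <= enorm x)%R. Proof. exact: sqrtr_ge0. Qed.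

Lemma sqr_enorm x : (enorm x ^+ 2 = \sum_i x 0 i ^+ 2)%R.
Proof.
by rewrite /enorm sqr_sqrtr /dot ?sumr_ge0// => i _; rewrite -expr2 sqr_ge0.
Qed.

Lemma coord_le_enorm x i : (`|x 0 i| <= enorm x)%R.
Proof.
rewrite -(ler_pXn2r (n := 2))// ?nnegrE ?enorm_ge0// sqr_enorm real_normK ?num_real//.
by rewrite (bigD1 i)//= lerDl sumr_ge0// => j _; rewrite sqr_ge0.
Qed.

(** Otherwise [v_i ^ 2 <= |v_i| < 1/n] for all [i], and the squares would sum to less than 1.
    Independence of [v] is what makes the later bounds uniform on the sphere. *)
Lemma sphere_coord_ge v : (0 < n)%N -> sphere v -> exists i, (n%:R^-1 <= `|v 0 i|)%R.
Proof.
move=> n0 v1; apply: contrapT => /forallNP h.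
have : (\sum_i v 0 i ^+ 2 < 1)%R.
  apply: (@lt_le_trans _ _ (\sum_(i < n) n%:R^-1)%R); last first.
    by rewrite sumr_const card_ord -[X in (X <= _)%R]mulr_natl mulfV// pnatr_eq0 -lt0n.
  apply: ltr_sum; first by apply/hasP; exists (Ordinal n0); rewrite ?mem_index_enum.
  move=> i _; have /negP := h i; rewrite -ltNge => hi.
  rewrite -real_normK ?num_real// expr2.
  have n1 : (n%:R^-1 <= 1 :> R)%R by rewrite invf_le1 ?ler1n ?ltr0n.
  have v1' : (`|v 0 i| <= 1)%R by rewrite (le_trans (ltW hi)).
  by apply: le_lt_trans hi; rewrite ler_piMl.
by rewrite -sqr_enorm v1 expr1n ltxx.
Qed.

Definition direction x : 'rV[R]_n := ((enorm x)^-1 *: x)%R.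

Lemma measurable_direction : measurable_fun setT direction.
Proof.
apply/measurable_rVP => i; under eq_fun do rewrite mxE.
apply: measurable_funM; last exact: measurable_coord_rV.
rewrite (_ : (fun _ => _) = (@powR R ^~ (-1)) \o @enorm R n)%R.
  by apply: measurableT_comp; [exact: measurable_powR|exact: measurable_enorm].
by apply/funext => x/=; rewrite powR_inv1 ?sqrtr_ge0.
Qed.

Lemma direction_sphere x : (0 < enorm x)%R -> sphere (direction x).
Proof. by move=> x0; rewrite /sphere/= enormZ ?invr_ge0 ?(ltW x0)// mulVf ?gt_eqF. Qed.

Lemma enorm_direction x : (0 < enorm x)%R -> x = (enorm x *: direction x)%R.
Proof. by move=> x0; rewrite scalerA divff ?scale1r ?gt_eqF. Qed.

Lemma directionZ t u : (0 < t)%R -> sphere u -> direction (t *: u) = u.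
Proof.
move=> t0 u1; rewrite /direction enormZ ?(ltW t0)// u1 mulr1 scalerA mulVf ?scale1r//.
by rewrite gt_eqF.
Qed.

(** The part of a star body over the directions in [A]. The origin is left out: it has no direction,
    and in positive dimension it is a null set. *)
Definition polar_set A (r : 'rV[R]_n -> R) : set 'rV[R]_n :=
  [set x | 0 < enorm x <= r (direction x)]%R `&` direction @^-1` A.

Lemma measurable_polar_set A r : measurable A -> measurable_fun setT r ->
  measurable (polar_set A r).
Proof.
move=> mA mr; apply: measurableI; last first.
  by rewrite -[X in measurable X]setTI; exact: measurable_direction.
rewrite (_ : [set x | _] = @enorm R n @^-1` `]0%R, +oo[%classic `&`
    (fun x => r (direction x) - enorm x)%R @^-1` `[0%R, +oo[%classic).
  apply: measurableI.
    by rewrite -[X in measurable X]setTI; exact: measurable_enorm.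
  rewrite -[X in measurable X]setTI.
  have mf : measurable_fun setT (fun x => r (direction x) - enorm x)%R.
    apply: measurable_funB; last exact: measurable_enorm.
    exact: (measurableT_comp mr measurable_direction).
  exact: mf.
by apply/seteqP; split=> x /=; rewrite !in_itv/= !andbT subr_ge0 => /andP.
Qed.

Lemma cone_polar A : cone A = polar_set A (cst 1%R).
Proof.
apply/seteqP; split=> [_ [t]/= + [u [Au u1] <-]|x [/= /andP[x0 x1] Ax]].
  rewrite in_itv/= => /andP[t0 t1]; split => /=; last by rewrite directionZ.
  by rewrite enormZ ?(ltW t0)// u1 mulr1 t0.
exists (enorm x); first by rewrite /= in_itv/= x0.
by exists (direction x); [split=> //; exact: direction_sphere|rewrite -enorm_direction].
Qed.

Lemma measurable_cone A : measurable A -> measurable (cone A).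
Proof. by move=> mA; rewrite cone_polar; apply: measurable_polar_set. Qed.

Lemma measurable_sphere : measurable (@sphere R n).
Proof.
rewrite -[X in measurable X]setTI.
exact: (@measurable_enorm R n measurableT [set 1%R]).
Qed.

Lemma polar_set_cst A (a : R) : (0 < a)%R ->
  polar_set A (cst a) = (fun x => a^-1 *: x)%R @^-1` cone A.
Proof.
move=> a0; rewrite cone_polar; have ai : (0 < a^-1)%R by rewrite invr_gt0.
apply/seteqP; split=> x; rewrite /polar_set/= enormZ ?(ltW ai)// => -[/andP[x0 xa] Ax].
  rewrite mulr_gt0// ler_pdivrMl// mulr1 xa; split => //.
  rewrite [X in direction X](_ : _ = (a^-1 * enorm x) *: direction x)%R.
    by rewrite directionZ ?mulr_gt0//; exact: direction_sphere.
  by rewrite -scalerA -enorm_direction.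
rewrite pmulr_rgt0// in x0; rewrite ler_pdivrMl// mulr1 in xa.
rewrite x0 xa; split=> //.
move: Ax; rewrite [X in direction X](_ : _ = (a^-1 * enorm x) *: direction x)%R.
  by rewrite directionZ ?mulr_gt0//; exact: direction_sphere.
by rewrite -scalerA -enorm_direction.
Qed.

Lemma lebesgue_polar_set_cst A (a : R) : (0 < a)%R -> measurable A ->
  n%:R%:E * lebesgue_rV R n (polar_set A (cst a)) = (a ^+ n)%:E * sphere_measure A.
Proof.
move=> a0 mA; rewrite polar_set_cst// lebesgue_rV_scale ?invr_gt0//; last exact: measurable_cone.
by rewrite exprVn invrK /sphere_measure muleCA.
Qed.

Lemma lebesgue_rV_set0 : (0 < n)%N -> lebesgue_rV R n [set 0%R] = 0.
Proof.
move=> n0; rewrite (_ : [set (0%R : 'rV[R]_n)] = [set x : 'rV[R]_n | forall i, [set 0%R] (x 0%R i)]).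
  rewrite (@lebesgue_rV_box R n (fun=> [set 0%R]))// (bigD1 (Ordinal n0))//=.
  by rewrite lebesgue_measure_set1 mul0e.
apply/seteqP; split=> x /= => [-> i|h]; first by rewrite mxE.
by apply/rowP => i; rewrite h mxE.
Qed.

Lemma measurable_set0_rV : measurable [set 0%R : 'rV[R]_n].
Proof.
rewrite (_ : [set (0%R : 'rV[R]_n)] = box 0%R); first exact: measurable_box.
apply/seteqP; split=> x /= => [-> i|h]; first by rewrite mxE in_itv/= oppr0 lexx.
apply/rowP => i; rewrite mxE; have := h i; rewrite in_itv/= oppr0 => /andP[h0 h1].
by apply/eqP; rewrite eq_le h0 h1.
Qed.

Lemma cone_sphere : cone (@sphere R n) = [set x | 0 < enorm x <= 1]%R.
Proof.
rewrite cone_polar; apply/seteqP; split=> x /=; first by case.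
by move=> /andP[x0 x1]; split=> /=; rewrite ?x0//; exact: direction_sphere.
Qed.

Lemma sphere_measure_gt0 : (0 < n)%N -> 0 < sphere_measure (@sphere R n).
Proof.
move=> n0; rewrite /sphere_measure mule_gt0 ?lte_fin ?ltr0n//.
have ni : (0 < n%:R^-1 :> R)%R by rewrite invr_gt0 ltr0n.
have mC := measurable_cone measurable_sphere; have m0 := measurable_set0_rV.
(* The cube of half-side [1/n] lies in the unit ball, which is the cone over the sphere together
   with the origin. *)
apply: (@lt_le_trans _ _ (lebesgue_rV R n (@box R n n%:R^-1))).
  by rewrite lebesgue_rV_boxE ?ltW// lte_fin exprn_gt0// mulrn_wgt0.
rewrite -[leRHS](measureU0 mC m0); last exact: lebesgue_rV_set0.
apply: le_measure; rewrite ?inE; [exact: measurable_box|exact: measurableU|].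
move=> x xb; have [->|x0] := eqVneq x 0%R; first by right.
left; rewrite cone_sphere /= lt_def enorm_ge0 andbT; apply/andP; split.
  apply: contra x0 => /eqP x0; apply/eqP/rowP => i; rewrite mxE.
  by apply/eqP; rewrite -normr_le0 (le_trans (coord_le_enorm x i))// x0.
rewrite -(ler_pXn2r (n := 2))// ?nnegrE ?enorm_ge0// sqr_enorm expr1n.
apply: (@le_trans _ _ (\sum_(i < n) n%:R^-1)%R); last first.
  by rewrite sumr_const card_ord -[X in (X <= _)%R]mulr_natl mulfV// pnatr_eq0 -lt0n.
apply: ler_sum => i _; rewrite -real_normK ?num_real// expr2.
have n1 : (n%:R^-1 <= 1 :> R)%R by rewrite invf_le1 ?ler1n ?ltr0n.
have xi : (`|x 0 i| <= n%:R^-1)%R by have := xb i; rewrite in_itv/= -ler_norml.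
by apply: le_trans (xi); rewrite ler_piMl// (le_trans xi).
Qed.

Lemma cone_box A : cone A `<=` box 1%R.
Proof.
rewrite cone_polar => x [/andP[_ x1] _] i.
by rewrite in_itv/= -ler_norml (le_trans (coord_le_enorm x i)).
Qed.

Lemma sphere_measure_le A : measurable A ->
  sphere_measure A <= (n%:R * 2 ^+ n)%:E.
Proof.
move=> mA; rewrite /sphere_measure EFinM; apply: lee_wpmul2l => //.
rewrite -[X in _ <= X](lebesgue_rV_boxE n ler01).
by apply: le_measure; rewrite ?inE; [exact: measurable_cone|exact: measurable_box|exact: cone_box].
Qed.

(** The factor [t <= 1] in [t *: u] can only shrink the inner product with [v], so the cone over the
    spherical slab stays in the solid slab of the same width. *)
Lemma sphere_measure_slab v e : (0 < n)%N -> sphere v -> (0 <= e)%R ->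
  sphere_measure (sphere `&` [set u | `|dot v u| <= e]%R) <=
    (n%:R * (2 ^+ n.-1 * (e *+ 2 * n%:R)))%:E.
Proof.
move=> n0 v1 e0; have [i vi] := sphere_coord_ge n0 v1.
have ni : (0 < n%:R^-1 :> R)%R by rewrite invr_gt0 ltr0n.
have vi0 : (0 < `|v 0 i|)%R by exact: lt_le_trans vi.
rewrite /sphere_measure EFinM; apply: lee_wpmul2l => //.
apply: (@le_trans _ _ (lebesgue_rV R n (slab v 0 1 e))).
  have mS : measurable (sphere `&` [set u : 'rV[R]_n | `|dot v u| <= e]%R).
    apply: measurableI; first exact: measurable_sphere.
    rewrite (_ : [set x | _] = (fun x => `|dot v x|%R) @^-1` `]-oo, e]%classic).
      rewrite -[X in measurable X]setTI.
      have mf : measurable_fun setT (fun x => `|dot v x|%R).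
        by apply: measurableT_comp => //; exact: measurable_linear_form.
      exact: mf.
    by apply/seteqP; split=> x /=; rewrite in_itv.
  apply: le_measure; rewrite ?inE; [exact: measurable_cone|exact: measurable_slab|].
  move=> x xc; split; first exact: cone_box xc.
  move: xc => [t /=]; rewrite in_itv/= => /andP[t0 t1] [u [[_ /= hu] u1] <-].
  have -> : dot v (t *: u) = (t * dot v u)%R.
    by rewrite /dot mulr_sumr; apply: eq_bigr => j _; rewrite !mxE mulrCA.
  rewrite add0r normrM (ger0_norm (ltW t0)).
  by apply: le_trans hu; rewrite ler_piMl.
have vi1 : v 0%R i != 0%R by rewrite -normr_gt0.
apply: (le_trans (lebesgue_rV_slab 0 ler01 e0 vi1)).
rewrite lee_fin ler_wpM2l ?exprn_ge0// ler_wpM2l ?mulrn_wge0//.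
by rewrite -[leRHS]invrK lef_pV2 ?posrE.
Qed.

End sphere_measure_theory.

(** * Volume in polar coordinates *)

Section polar_coordinates.
Context (R : realType) (n : nat).
Local Open Scope ereal_scope.
Implicit Types (A : set 'rV[R]_n).

Lemma ereal_le_of_mul_gt1 (x y : \bar R) : 0 <= x -> y \is a fin_num ->
  (forall t : R, (1 < t)%R -> x <= t%:E * y) -> x <= y.
Proof.
move=> x0 yfin h.
have xfin : x \is a fin_num.
  rewrite ge0_fin_numE//; apply: (@le_lt_trans _ _ (2%:E * y)); first exact/h/ltr1n.
  by rewrite -(fineK yfin) -EFinM ltry.
move: x0 h; rewrite -(fineK xfin) -(fineK yfin); move: (fine x) (fine y) => {xfin yfin}x' y'.
rewrite !lee_fin => x0 h; rewrite leNgt; apply/negP => yx.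
have [y0|y0] := leP y' 0%R.
  have := h 2%R (ltr1n _ _); rewrite -EFinM lee_fin => h2.
  by have : (2 * y' <= y')%R; lra.
(* For this factor [t] one has [t y' = (x' + y') / 2], and the hypothesis would give [x' <= y']. *)
have t1 : (1 < (x' + y') / (2 * y'))%R by rewrite ltr_pdivlMr ?mulr_gt0//; lra.
have := h _ t1; rewrite -EFinM lee_fin (_ : (x' + y') / (2 * y') * y' = (x' + y') / 2)%R; last first.
  by field; rewrite gt_eqF.
by lra.
Qed.

Lemma polar_set_le A (r1 r2 : 'rV[R]_n -> R) :
  (forall u, sphere u -> A u -> r1 u <= r2 u)%R -> polar_set A r1 `<=` polar_set A r2.
Proof.
move=> r12 x [/= /andP[x0 xr] Ax]; split => //=; rewrite x0 (le_trans xr)//.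
by apply: r12 => //; exact: direction_sphere.
Qed.

Section formula.
Variables (r : 'rV[R]_n -> R) (c C : R).
Hypotheses (mr : measurable_fun setT r) (c0 : (0 < c)%R)
  (rcC : forall u, sphere u -> (c <= r u <= C)%R).

Let nu1 A := n%:R%:E * lebesgue_rV R n (polar_set A r).
Let nu2 A := \int[@sphere_measure R n]_(u in A) (r u ^+ n)%:E.

Let r0 u : sphere u -> (0 < r u)%R.
Proof. by move=> /rcC/andP[+ _]; exact: lt_le_trans. Qed.

Let mrn A : measurable_fun A (fun u => (r u ^+ n)%:E).
Proof. by apply/measurable_EFinP/measurable_funTS; apply: measurable_funX. Qed.

Let nu1_bounds A a b : measurable A -> A `<=` sphere -> (0 < a)%R -> (0 < b)%R ->
  (forall u, A u -> a <= r u <= b)%R ->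
  (a ^+ n)%:E * sphere_measure A <= nu1 A <= (b ^+ n)%:E * sphere_measure A.
Proof.
move=> mA AS a0 b0 rab; rewrite -!lebesgue_polar_set_cst//.
apply/andP; split; apply: lee_wpmul2l => //; apply: le_measure; rewrite ?inE;
  try exact: measurable_polar_set;
  by apply: polar_set_le => u _ /rab/andP[].
Qed.

Let nu2_bounds A a b : measurable A -> A `<=` sphere -> (0 < a)%R -> (0 < b)%R ->
  (forall u, A u -> a <= r u <= b)%R ->
  (a ^+ n)%:E * sphere_measure A <= nu2 A <= (b ^+ n)%:E * sphere_measure A.
Proof.
move=> mA AS a0 b0 rab; rewrite -!integral_cst//.
have rn0 u : A u -> (0 <= r u ^+ n)%R by move=> /AS/r0/ltW ru; exact: exprn_ge0.
apply/andP; split; apply: ge0_le_integral => //.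
- by move=> u _ /=; rewrite lee_fin exprn_ge0// ltW.
- move=> u Au /=; have /andP[ar _] := rab u Au; rewrite lee_fin.
  by apply: lerXn2r => //; rewrite nnegrE ltW// r0//; exact: AS.
- move=> u Au /=; have /andP[_ rb] := rab u Au; rewrite lee_fin.
  by apply: lerXn2r => //; rewrite nnegrE ltW// r0//; exact: AS.
Qed.

(* [nu1] and [nu2] agree up to the factor [t] on each shell where [r] varies by
   a factor at most [t ^ (1 / n)]. *)
Let nu_compare (t : R) : (0 < n)%N -> (1 < t)%R ->
  nu1 sphere <= t%:E * nu2 sphere /\ nu2 sphere <= t%:E * nu1 sphere.
Proof.
move=> n0 t1; pose d := (ln t / n%:R)%R.
have d0 : (0 < d)%R by rewrite divr_gt0 ?ltr0n// ln_gt0.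
(* The logarithm of [r / c] in units of [d]: its integer part is the index of the shell, and each
   step to the next shell multiplies the bound on [r ^ n] by exactly [t]. *)
pose g u := (ln (r u / c) / d)%R.
pose A k := sphere `&` [set u | k%:R <= g u < k.+1%:R]%R.
have mA k : measurable (A k).
  apply: measurableI; first exact: measurable_sphere.
  rewrite (_ : [set u | _] = g @^-1` `[k%:R, k.+1%:R[%classic)%R; last first.
    by apply/seteqP; split=> u; rewrite /= in_itv.
  rewrite -[X in measurable X]setTI.
  have mg : measurable_fun setT g.
    apply: measurable_funM => //; apply: measurableT_comp => //.
    exact: measurable_funM.
  exact: mg.
have AS k : A k `<=` sphere by move=> u [].
have tA : trivIset setT A.
  apply/trivIsetP => i j _ _ ij; apply/seteqP; split=> u //= [[_ /= ui] [_ /= uj]].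
  by move/eqP: ij; apply; rewrite -(truncn_def ui) (truncn_def uj).
have g0 u : sphere u -> (0 <= g u)%R.
  move=> u1; rewrite divr_ge0 ?(ltW d0)// ln_ge0// ler_pdivlMr// mul1r.
  by case/andP: (rcC u1).
have SA : sphere = \bigcup_k A k.
  apply/seteqP; split=> [u u1|u [k _]]; last exact: AS.
  by exists (Num.trunc (g u)) => //; split=> //=; exact/truncn_itv/g0.
pose a k := (c * expR (k%:R * d))%R.
have a0 k : (0 < a k)%R by rewrite mulr_gt0// expR_gt0.
have aS k : (a k.+1 ^+ n = t * a k ^+ n)%R.
  rewrite /a !exprMn [RHS]mulrCA -!expRM_natl; congr (_ * _)%R.
  rewrite -[X in _ = (X * _)%R](@lnK R t) ?posrE ?(lt_trans ltr01)// -expRD; congr expR.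
  by rewrite /d -natr1; field; rewrite pnatr_eq0 -lt0n.
have ra k u : A k u -> (a k <= r u <= a k.+1)%R.
  move=> [u1 /= /andP[gk gk1]].
  have -> : r u = (c * expR (g u * d))%R.
    rewrite /g divfK ?gt_eqF// lnK ?posrE ?divr_gt0// ?r0//.
    by rewrite mulrCA divff ?mulr1// gt_eqF.
  by rewrite !ler_pM2l// !ler_expR !ler_pM2r// gk ltW.
have cmp1 k : nu1 (A k) <= t%:E * nu2 (A k).
  have /andP[_ h1] := nu1_bounds (mA k) (AS k) (a0 k) (a0 k.+1) (ra k).
  have /andP[h2 _] := nu2_bounds (mA k) (AS k) (a0 k) (a0 k.+1) (ra k).
  apply: (le_trans h1); rewrite aS EFinM -muleA; apply: lee_wpmul2l => //.
  by rewrite lee_fin ltW// (lt_trans ltr01).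
have cmp2 k : nu2 (A k) <= t%:E * nu1 (A k).
  have /andP[h1 _] := nu1_bounds (mA k) (AS k) (a0 k) (a0 k.+1) (ra k).
  have /andP[_ h2] := nu2_bounds (mA k) (AS k) (a0 k) (a0 k.+1) (ra k).
  apply: (le_trans h2); rewrite aS EFinM -muleA; apply: lee_wpmul2l => //.
  by rewrite lee_fin ltW// (lt_trans ltr01).
have nu10 k : 0 <= nu1 (A k) by rewrite mule_ge0// lee_fin ler0n.
have nu20 k : 0 <= nu2 (A k).
  by apply: integral_ge0 => u /AS/r0/ltW ru; rewrite lee_fin exprn_ge0.
have s1 : nu1 sphere = \sum_(k <oo) nu1 (A k).
  rewrite /nu1 nneseriesZl//; congr (_ * _).
  rewrite {1}SA (_ : polar_set _ r = \bigcup_k polar_set (A k) r); last first.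
    apply/seteqP; split=> x; first by move=> [xr [k _ Ak]]; exists k.
    by move=> [k _ [xr Ak]]; split => //; exists k.
  apply: measure_semi_bigcup => //.
  - by move=> k; exact: measurable_polar_set.
  - apply/trivIsetP => i j _ _ ij; apply/seteqP; split=> x //= [[_ xi] [_ xj]].
    by have /trivIsetP/(_ i j Logic.I Logic.I ij)/seteqP[+ _] := tA; apply; split; [exact: xi|exact: xj].
  - by apply: bigcup_measurable => k _; exact: measurable_polar_set.
have s2 : nu2 sphere = \sum_(k <oo) nu2 (A k).
  rewrite /nu2 {1}SA ge0_integral_bigcup// -?SA// => u /r0/ltW ru.
  by rewrite lee_fin exprn_ge0.
by rewrite s1 s2 -!nneseriesZl//; split; apply: lee_nneseries.
Qed.

Lemma integral_sphere_radial : (0 < n)%N ->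
  n%:R%:E * lebesgue_rV R n (polar_set setT r) =
  \int[@sphere_measure R n]_(u in sphere) (r u ^+ n)%:E.
Proof.
move=> n0.
have -> : polar_set setT r = polar_set sphere r.
  apply/seteqP; split=> x [/= h _] //; split => //=.
  by apply: direction_sphere; case/andP: h.
rewrite -/(nu1 sphere) -/(nu2 sphere).
have mS := @measurable_sphere R n.
(* The maximum with [c] provides a positive upper bound without exhibiting a point of the sphere. *)
pose b := Num.max c C.
have b0 : (0 < b)%R by rewrite lt_max c0.
have rb u : sphere u -> (c <= r u <= b)%R.
  by move=> /rcC/andP[-> /= rC]; rewrite le_max rC orbT.
have fin (x : \bar R) : 0 <= x -> x <= (b ^+ n)%:E * sphere_measure (@sphere R n) ->
    x \is a fin_num.
  move=> x0 xb; rewrite ge0_fin_numE//; apply: (le_lt_trans xb).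
  rewrite lte_mul_pinfty// ?lee_fin ?exprn_ge0 ?ltW//.
  by apply: le_lt_trans (sphere_measure_le mS) _; rewrite ltry.
have nu10 : 0 <= nu1 sphere by rewrite mule_ge0// lee_fin ler0n.
have nu20 : 0 <= nu2 sphere.
  by apply: integral_ge0 => u /r0/ltW ru; rewrite lee_fin exprn_ge0.
have /andP[_ /(fin _ nu10) fin1] := nu1_bounds mS (fun _ => id) c0 b0 rb.
have /andP[_ /(fin _ nu20) fin2] := nu2_bounds mS (fun _ => id) c0 b0 rb.
by apply/eqP; rewrite eq_le; apply/andP; split; apply: ereal_le_of_mul_gt1 => // t t1;
  have [? ?] := nu_compare n0 t1.
Qed.

Lemma star_body_polar : (0 < n)%N ->
  star_body r = polar_set setT r `|` [set 0%R].
Proof.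
move=> n0; apply/seteqP; split=> [_ [u u1 [t /andP[t0 tr] ->]]|x].
  have [->|tN0] := eqVneq t 0%R; first by right; rewrite /= scale0r.
  have {}t0 : (0 < t)%R by rewrite lt_def tN0.
  by left; split=> //=; rewrite directionZ// enormZ ?(ltW t0)// u1 mulr1 t0.
move=> [[/= /andP[x0 xr] _]|/= ->].
  exists (direction x); first exact: direction_sphere.
  by exists (enorm x); [rewrite enorm_ge0|exact: enorm_direction].
(* The origin enters [star_body] only as [0 *: u] for some unit vector [u], so a point of the sphere
   is required. *)
have [u u1] : @sphere R n !=set0.
  apply/set0P/eqP => S0; have := sphere_measure_gt0 R n0.
  by rewrite S0 measure0 ltxx.
by exists u => //; exists 0%R; rewrite ?scale0r// lexx ltW// r0.
Qed.

Lemma volume_star_body : (0 < n)%N ->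
  (n%:R * volume (star_body r) =
   \int[@sphere_measure R n]_(u in sphere) (r u ^+ n))%R.
Proof.
move=> n0; rewrite /volume star_body_polar// measureU0; last 3 first.
- exact: measurable_polar_set.
- exact: measurable_set0_rV.
- exact: lebesgue_rV_set0.
rewrite /Rintegral -integral_sphere_radial//.
have fineMl (x : \bar R) : (n%:R * fine x)%R = fine (n%:R%:E * x).
  case: x => [x| |]//.
    by rewrite gt0_muley ?lte_fin ?ltr0n// mulr0.
  by rewrite gt0_muleNy ?lte_fin ?ltr0n// mulr0.
exact: fineMl.
Qed.

End formula.
End polar_coordinates.

(** * Convex bodies *)

Section weighted_estimate.
Context d (T : measurableType d) (R : realType) (mu : {measure set T -> \bar R}).

(** Used with [w = 1] on the convex body and with [w = rho ^ (n - p)] on the sphere. The latter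
    depends on [p], so the weight enters the bound only through [B]. *)
Lemma Rintegral_mul_powR_dist (D : set T) (f w : T -> R) (B C M p : R) :
  measurable D -> measurable_fun D f -> measurable_fun D w ->
  (forall x, D x -> 0 <= f x <= M) -> (forall x, D x -> `|w x| <= B) ->
  0 <= B -> 0 <= C -> (mu D <= C%:E)%E ->
  (forall e : R, 0 < e -> (mu (D `&` [set x | f x <= e]%R) <= (C * e)%:E)%E) ->
  `|p| <= 4^-1 ->
  `|\int[mu]_(x in D) (w x * f x `^ (- p)) - \int[mu]_(x in D) w x| <=
    B * (`|p| * (4 * ((Num.sqrt M + 4) * C))).
Proof.
move=> mD mf mw f0M wB B0 C0 muD hC p4.
have bnd := integral_powR_sub1_le mD mf f0M C0 muD hC p4.
set E := `|p| * _ in bnd *.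
have mg : measurable_fun D (fun x => f x `^ (- p) - 1).
  by apply: measurable_funB => //; exact: (measurableT_comp (measurable_powR (- p)) mf).
have mwg : measurable_fun D (fun x => w x * (f x `^ (- p) - 1)) by exact: measurable_funM.
have le1 : (\int[mu]_(x in D) (`|w x * (f x `^ (- p) - 1)|)%:E <= (B * E)%:E)%E.
  apply: (@le_trans _ _ (\int[mu]_(x in D) (B%:E * (`|f x `^ (- p) - 1|)%:E))%E).
    apply: ge0_le_integral => //.
    - by apply/measurable_EFinP; exact: measurableT_comp.
    - by apply: measurable_funeM; apply/measurable_EFinP; exact: measurableT_comp.
    by move=> x Dx; rewrite -EFinM lee_fin normrM ler_wpM2r// wB.
  rewrite ge0_integralZl_EFin//; last by apply/measurable_EFinP; exact: measurableT_comp.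
  by rewrite EFinM; apply: lee_wpmul2l.
have iwg : mu.-integrable D (EFin \o (fun x => w x * (f x `^ (- p) - 1))).
  apply/integrableP; split; first exact/measurable_EFinP.
  by apply: (le_lt_trans le1); rewrite ltry.
have iw : mu.-integrable D (EFin \o w).
  apply/integrableP; split; first exact/measurable_EFinP.
  apply: (@le_lt_trans _ _ (\int[mu]_(x in D) (cst B%:E x))%E).
    apply: ge0_le_integral => //.
    by apply/measurable_EFinP; exact: measurableT_comp.
  rewrite (integral_cst mu mD B%:E) lte_mul_pinfty ?lee_fin//.
  by apply: (le_lt_trans muD); rewrite ltry.
have -> : \int[mu]_(x in D) (w x * f x `^ (- p)) =
    \int[mu]_(x in D) (w x + w x * (f x `^ (- p) - 1)).
  by apply: eq_Rintegral => x _; ring.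
rewrite RintegralD// addrC addKr.
apply: (le_trans (le_normr_Rintegral mD iwg)).
rewrite -lee_fin /Rintegral fineK//.
rewrite ge0_fin_numE; first by apply: (le_lt_trans le1); rewrite ltry.
by apply: integral_ge0 => x _; rewrite lee_fin.
Qed.

End weighted_estimate.

(** * Compact sets, their radial functions and slabs *)

Section convex_body_geometry.
Context (R : realType) (n : nat).
Implicit Types (K : set 'rV[R]_n) (u v : 'rV[R]_n).
Hypothesis n0 : (0 < n)%N.

Lemma compact_measurable_rV K : compact K -> measurable K.
Proof.
move=> cK; rewrite -[K]setCK; apply: measurableC; apply: open_measurable_rV.
apply: closed_openC; apply: compact_closed => //; exact: norm_hausdorff.
Qed.

Lemma compact_subset_box K : compact K -> exists2 M, 1 <= M & K `<=` box M.
Proof.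
move=> /compact_bounded [M0 [_ hM]].
exists (Num.max 1 (M0 + 1)); first by rewrite le_max lexx.
move=> x Kx i; rewrite in_itv/= -ler_norml.
have : M0 < Num.max 1 (M0 + 1) by rewrite lt_max ltrDl ltr01 orbT.
move=> /hM/(_ _ Kx) /=; apply: le_trans.
by rewrite [leRHS]/Num.Def.normr/= mx_normrE (le_trans _ (le_bigmax _ _ (ord0, i))).
Qed.

Lemma interior_sphere_dilate K : K° 0 -> exists2 e, 0 < e & forall u, sphere u -> K (e *: u).
Proof.
move=> /nbhs_ballP[e /= e0 eK]; exists (e / 2); first by rewrite divr_gt0.
move=> u u1; apply: eK; split => // i j; rewrite ord1 !mxE /ball/= sub0r normrN normrM.
have ui : `|u 0 j| <= 1 by have := coord_le_enorm u j; rewrite u1.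
by rewrite (ger0_norm (ltW (divr_gt0 e0 (ltr0n _ 2)))); nra.
Qed.

(** A coordinate of [u] of absolute value at least [1/n] forces [t <= M n] whenever [t *: u] lies in
    the box. *)
Lemma radial_bounds K (e M : R) u : 0 < e -> K `<=` box M -> sphere u ->
  K (e *: u) -> e <= radial K u <= M * n%:R.
Proof.
move=> e0 KM u1 Ku; have [i ui] := sphere_coord_ge n0 u1.
have ub : ubound [set t | 0 <= t /\ K (t *: u)] (M * n%:R).
  move=> t [t0 /KM /(_ i)]; rewrite in_itv/= -ler_norml mxE normrM (ger0_norm t0) => tM.
  rewrite -ler_pdivrMr ?ltr0n//; apply: le_trans tM.
  by rewrite ler_wpM2l.
apply/andP; split.
  by apply: ub_le_sup; [exists (M * n%:R)|split=> //; exact: ltW].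
by apply: ge_sup => //; exists e; split=> //; exact: ltW.
Qed.

Lemma dot_sphere_box_le u y (M : R) : sphere u -> box M y -> `|dot u y| <= M * n%:R.
Proof.
move=> u1 yM; apply: (le_trans (ler_norm_sum _ _ _)).
apply: (@le_trans _ _ (\sum_(i < n) M)); last first.
  by rewrite sumr_const card_ord mulr_natr.
apply: ler_sum => i _; rewrite normrM.
have ui : `|u 0 i| <= 1 by have := coord_le_enorm u i; rewrite u1.
have yi : `|y 0 i| <= M by have := yM i; rewrite in_itv/= -ler_norml.
by rewrite -[leRHS]mul1r ler_pM.
Qed.

Lemma lebesgue_rV_slab_le K u (M e : R) : measurable K -> 0 <= M -> K `<=` box M ->
  sphere u -> 0 < e ->
  (lebesgue_rV R n (K `&` [set y | (`|dot u y| <= e)%R]) <=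
    (((M *+ 2) ^+ n.-1 * (n%:R *+ 2)) * e)%:E)%E.
Proof.
move=> mK M0 KM u1 e0; have [i ui] := sphere_coord_ge n0 u1.
have ni : 0 < n%:R^-1 :> R by rewrite invr_gt0 ltr0n.
have ui0 : 0 < `|u 0 i| by exact: lt_le_trans ui.
have ui1 : u 0 i != 0 by rewrite -normr_gt0.
apply: (@le_trans _ _ (lebesgue_rV R n (slab u 0 M e))).
  apply: le_measure; rewrite ?inE.
  - apply: measurableI => //.
    rewrite (_ : [set x | _] = (fun x => `|dot u x|) @^-1` `]-oo, e]%classic).
      rewrite -[X in measurable X]setTI.
      have mf : measurable_fun setT (fun x => `|dot u x|).
        by apply: measurableT_comp => //; exact: measurable_linear_form.
      exact: mf.
    by apply/seteqP; split=> x /=; rewrite in_itv.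
  - exact: measurable_slab.
  by move=> y [/KM yM /= ye]; split=> //=; rewrite add0r.
apply: (le_trans (lebesgue_rV_slab 0 M0 (ltW e0) ui1)).
rewrite lee_fin -mulrA ler_wpM2l ?exprn_ge0 ?mulrn_wge0//.
have h : `|u 0 i|^-1 <= n%:R by rewrite -[leRHS]invrK lef_pV2 ?posrE.
by have := ler_wpM2l (ltW e0) h; rewrite !mulr2n; lra.
Qed.

(** The regularity that the polar formula for the volume asks of a radial function. It follows from
    Tonelli once [K] is moved into the integrand as an indicator, which makes the integrand jointly
    measurable. *)
Lemma measurable_Lp_intersection_radial K (p : R) : measurable K ->
  measurable_fun setT (Lp_intersection_radial p K).
Proof.
move=> mK; rewrite /Lp_intersection_radial.
apply: (measurableT_comp (measurable_powR p^-1)).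
apply: measurable_funM => //.
rewrite /Rintegral; apply: (measurableT_comp (fine_measurable measurableT)).
pose f (z : 'rV[R]_n * 'rV[R]_n) := (`|dot z.1 z.2| `^ (- p) * \1_K z.2)%:E.
have mf : measurable_fun setT f.
  apply/measurable_EFinP; apply: measurable_funM.
    apply: (measurableT_comp (measurable_powR (- p))).
    apply: measurableT_comp => //; apply: measurable_sum => i.
    apply: measurable_funM.
      by apply: (measurableT_comp (measurable_coord_rV i)); exact: measurable_fst.
    by apply: (measurableT_comp (measurable_coord_rV i)); exact: measurable_snd.
  by apply: (measurableT_comp (measurable_indic mK)); exact: measurable_snd.
have f0 z : (0 <= f z)%E by rewrite lee_fin mulr_ge0 ?powR_ge0.
have := measurable_fun_fubini_tonelli_F (m2 := lebesgue_rV R n) f mf f0.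
apply: eq_measurable_fun => x _; rewrite /fubini_F [RHS]integral_mkcond.
apply: eq_integral => y _; rewrite /f patchE/= indicE.
by case: ifPn => yK; rewrite ?mulr1 ?mulr0.
Qed.

End convex_body_geometry.

(** * Convergence *)

Section real_estimates.
Context (R : realType).
Implicit Types x p : R.

Lemma ln_near1 x (e : R) : `|x - 1| <= e -> e <= 2^-1 ->
  `|ln x| <= 2 * e /\ `|x^-1 - 1| <= 2 * e.
Proof.
rewrite ler_norml => /andP[x1 x2] e2; have x0 : 0 < x by lra.
have h1 : ln x <= x - 1.
  by rewrite -{1}(subrKC 1 x) le_ln1Dx//; lra.
have E : x^-1 - 1 = (1 - x) / x by field; rewrite gt_eqF.
have e0 : 0 <= e by lra.
have b : - (2 * e) <= x^-1 - 1 <= 2 * e.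
  rewrite E ler_pdivlMr// ler_pdivrMr//; apply/andP; split; nra.
have h2 : - ln x <= x^-1 - 1.
  rewrite -lnV ?posrE// -{1}(subrKC 1 x^-1) le_ln1Dx//.
  by rewrite ltrBrDr addrC subrr invr_gt0.
split; rewrite ler_norml; case/andP: b => b1 b2; last by rewrite b1 b2.
by apply/andP; split; lra.
Qed.

Lemma cvg_dnbhs0_dist (F : R -> R) (L C d : R) : 0 < d ->
  (forall p, 0 < `|p| < d -> `|F p - L| <= C * `|p|) -> F p @[p --> 0^'] --> L.
Proof.
move=> d0 h; apply/cvgrPdist_le => /= e e0.
have m0 : 0 < Num.min d (e / (`|C| + 1)).
  by rewrite lt_min d0 divr_gt0// ltr_wpDl.
apply/nbhs_ballP; exists (Num.min d (e / (`|C| + 1))) => //= p.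
rewrite /ball/= sub0r normrN lt_min => /andP[pd pe] p0.
rewrite distrC; apply: (le_trans (h p _)); first by rewrite normr_gt0 p0.
move: pe; rewrite ltr_pdivlMr ?ltr_wpDl// => pe.
have := ler_norm C; have : 0 <= `|p| by []; have : 0 <= `|C| by [].
by nra.
Qed.

End real_estimates.

(** * Uniform estimates for the intersection body and the cosine transform *)

Section Lp_intersection_estimates.
Context (R : realType) (n : nat).
Hypothesis n0 : (0 < n)%N.
Implicit Types (K : set 'rV[R]_n) (u v : 'rV[R]_n) (p : R).

(* With [X] the base of the power defining [rho], the hypothesis [V(K) = 2] gives
   [X = 1 + O(p)]; hence [ln rho = (ln X) / p] stays bounded and
   [rho ^ (- p) = X^-1 = 1 + O(p)]. *)
Lemma Lp_intersection_radial_bounds K : compact K -> volume K = 2 ->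
  exists C, 0 < C /\ forall p u, 0 < `|p| <= C^-1 -> sphere u ->
    [/\ (expR C)^-1 <= Lp_intersection_radial p K u <= expR C &
      `|Lp_intersection_radial p K u `^ (n%:R - p) -
        Lp_intersection_radial p K u ^+ n| <= expR C ^+ n * (C * `|p|)].
Proof.
move=> cK vK; have mK := compact_measurable_rV cK.
have [M M1 KM] := compact_subset_box cK.
have M0 : 0 <= M by exact: le_trans M1.
pose C1 := Num.max 2 ((M *+ 2) ^+ n.-1 * (n%:R *+ 2)).
have C10 : 0 <= C1 by rewrite le_max ler0n.
have KE : lebesgue_rV R n K = 2%:E.
  by move: vK; rewrite /volume; case: (lebesgue_rV R n K) => [r /= ->| /= | /=]//;
    move/eqP; rewrite eq_sym pnatr_eq0.
pose C2 := 4 * ((Num.sqrt (M * n%:R) + 4) * C1).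
have C20 : 0 <= C2 by rewrite mulr_ge0// mulr_ge0// addr_ge0// sqrtr_ge0.
have Jdist p u : `|p| <= 4^-1 -> sphere u ->
    `|\int[lebesgue_rV R n]_(y in K) (`|dot u y| `^ (- p)) - 2| <= `|p| * C2.
  move=> p4 u1.
  have := @Rintegral_mul_powR_dist _ _ R (lebesgue_rV R n) K (fun y => `|dot u y|)
    (cst 1) 1 C1 (M * n%:R) p mK.
  have -> : \int[lebesgue_rV R n]_(x in K) (cst 1 x * `|dot u x| `^ (- p)) =
      \int[lebesgue_rV R n]_(y in K) (`|dot u y| `^ (- p)).
    by apply: eq_Rintegral => y _; rewrite mul1r.
  rewrite [X in _ - X](_ : _ = 2) ?mul1r; last first.
    rewrite Rintegral_cst// mul1r; by rewrite -vK.
  apply => //.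
  - apply: measurable_funTS; apply: measurableT_comp => //; exact: measurable_linear_form.
  - by move=> y Ky; rewrite normr_ge0/= dot_sphere_box_le//; exact: KM.
  - by move=> y _; rewrite normr1.
  - by rewrite [X in (X <= _)%E]KE lee_fin /C1 le_max lexx.
  - move=> e e0; apply: (le_trans (lebesgue_rV_slab_le n0 mK M0 KM u1 e0)).
    by rewrite lee_fin ler_wpM2r ?(ltW e0)// /C1 le_max lexx orbT.
(* For [|p| <= 1/C] the error [2 |p| (C2 + 1)] of [X] is at most 1/2. Then [ln_near1] bounds both
   [|ln X|] and [|1/X - 1|] by [4 |p| (C2 + 1) = C |p|], and division by [|p|] leaves
   [|ln rho| <= C]. *)
pose C := 4 * (C2 + 1).
have C0 : 0 < C by rewrite mulr_gt0// ltr_wpDl.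
exists C; split => // p u /andP[p0 pC] u1.
have pC4 : `|p| * (C2 + 1) <= 4^-1.
  have : `|p| * C <= 1 by rewrite -ler_pdivlMr// div1r.
  by rewrite /C; lra.
have p4 : `|p| <= 4^-1 by nra.
set rho := Lp_intersection_radial p K u.
pose X := (1 - p) / 2 * \int[lebesgue_rV R n]_(y in K) (`|dot u y| `^ (- p)).
have rhoE : rho = X `^ p^-1 by [].
have X1 : `|X - 1| <= 2 * (`|p| * (C2 + 1)).
  have := Jdist p u p4 u1; rewrite /X; set J := Rintegral _ _ _ => hJ.
  (* The volume 2 cancels the denominator of the normalisation: [(1 - p) / 2 * 2 - 1 = - p]. *)
  rewrite (_ : _ - 1 = (1 - p) / 2 * (J - 2) - p); last by field.
  apply: (le_trans (ler_normB _ _)); rewrite normrM.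
  have hp : `|(1 - p) / 2| <= 1.
    by move: p4; rewrite !ler_norml => /andP[? ?]; apply/andP; split; lra.
  have : `|(1 - p) / 2| * `|J - 2| <= 1 * (`|p| * C2) by apply: ler_pM.
  have : 0 <= `|p| * C2 by rewrite mulr_ge0.
  by have : 0 <= `|p| by []; lra.
have Xe : 2 * (`|p| * (C2 + 1)) <= 2^-1 by lra.
have [lnX Xi] := ln_near1 X1 Xe.
have X0 : 0 < X by move: X1; rewrite ler_norml => /andP[? ?]; lra.
have pN0 : p != 0 by rewrite -normr_gt0.
have rhoe : rho = expR (p^-1 * ln X) by rewrite rhoE /powR gt_eqF.
have lnrho : `|p^-1 * ln X| <= C.
  rewrite normrM normfV ler_pdivrMl//; apply: (le_trans lnX).
  by rewrite /C; lra.
have rhob : (expR C)^-1 <= rho <= expR C.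
  by rewrite -expRN rhoe !ler_expR -ler_norml.
have rho0 : 0 < rho by rewrite rhoe expR_gt0.
split=> //.
have -> : rho `^ (n%:R - p) = rho ^+ n * X^-1.
  rewrite powRD ?(gt_eqF rho0) ?implybT// powR_mulrn ?ltW//; congr (_ * _).
  by rewrite rhoE -powRrM mulrN mulVf// powR_inv1 ?ltW.
rewrite -[X in _ - X]mulr1 -mulrBr normrM.
rewrite ger0_norm ?exprn_ge0 ?(ltW rho0)//; apply: ler_pM => //.
- by rewrite exprn_ge0// ltW.
- by apply: lerXn2r; rewrite ?nnegrE ?expR_ge0 ?(ltW rho0)//; case/andP: rhob.
by apply: (le_trans Xi); rewrite /C; lra.
Qed.

(** The constants depend on neither [p] nor [v]. The lower bound [c] allows a later division by the
    volume of the intersection body, which still varies with [p]. *)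
Lemma cosine_transform_estimate K : compact K -> volume K = 2 ->
  exists c C d : R, [/\ 0 < c, 0 < C, 0 < d & forall p, 0 < `|p| <= d ->
    c <= n%:R * volume (Lp_intersection_body p K) <= C /\
    forall v, sphere v ->
      `|cosine_transform (- p)
          (fun u => radial (Lp_intersection_body p K) u `^ (n%:R - p)) v -
        n%:R * volume (Lp_intersection_body p K)| <= C * `|p|].
Proof.
move=> cK vK; have mK := compact_measurable_rV cK.
have [C [C0 HC]] := Lp_intersection_radial_bounds cK vK.
have mS := @measurable_sphere R n.
pose s := fine (sphere_measure (@sphere R n)).
have Sle := sphere_measure_le mS.
have Sfin : sphere_measure (@sphere R n) \is a fin_num.
  by rewrite ge0_fin_numE//; apply: (le_lt_trans Sle); rewrite ltry.
have sE : sphere_measure (@sphere R n) = s%:E by rewrite fineK.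
have Soo : (sphere_measure (@sphere R n) < +oo)%E by rewrite sE ltry.
have s0 : 0 < s by rewrite -lte_fin -sE; exact: sphere_measure_gt0.
pose C1 : R := Num.max (n%:R * 2 ^+ n) (n%:R * (2 ^+ n.-1 * (n%:R *+ 2))).
have C10 : 0 <= C1 by rewrite le_max mulr_ge0 ?exprn_ge0.
pose E := expR C; have E0 : 0 < E by exact: expR_gt0.
(* A bound for [rho ^ (n - p)]: it differs from [rho ^ n <= E ^ n] by at most [E ^ n * (C * |p|)],
   and [C * |p| <= 1]. *)
pose B := E ^+ n * 2.
have B0 : 0 <= B by rewrite mulr_ge0// exprn_ge0// ltW.
pose C2 := B * (4 * ((Num.sqrt n%:R + 4) * C1)).
have C20 : 0 <= C2 by rewrite mulr_ge0// mulr_ge0// mulr_ge0// addr_ge0// sqrtr_ge0.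
pose D := E ^+ n * C * s.
have D0 : 0 <= D by rewrite !mulr_ge0 ?exprn_ge0 ?ltW.
exists (E^-1 ^+ n * s), (E ^+ n * s + C2 + D), (Num.min C^-1 4^-1); split.
- by rewrite mulr_gt0// exprn_gt0// invr_gt0.
- by rewrite -addrA ltr_wpDr ?addr_ge0// mulr_gt0// exprn_gt0.
- by rewrite lt_min !invr_gt0 C0 ltr0n.
move=> p; rewrite le_min => /andP[p0 /andP[pC p4]].
have pC' : 0 < `|p| <= C^-1 by rewrite p0.
pose rho := Lp_intersection_radial p K.
have rb u : sphere u -> E^-1 <= rho u <= E by move=> /(HC _ _ pC')[].
have rd u : sphere u -> `|rho u `^ (n%:R - p) - rho u ^+ n| <= E ^+ n * (C * `|p|).
  by move=> /(HC _ _ pC')[].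
have r0 u : sphere u -> 0 < rho u.
  by move=> /rb/andP[+ _]; apply: lt_le_trans; rewrite invr_gt0.
have mrho : measurable_fun setT rho by exact: measurable_Lp_intersection_radial.
have Ei0 : 0 < E^-1 by rewrite invr_gt0.
have VE := volume_star_body mrho Ei0 rb n0.
rewrite -/(Lp_intersection_body p K) in VE.
set W := n%:R * _ in VE *.
have rn u : sphere u -> E^-1 ^+ n <= rho u ^+ n <= E ^+ n.
  move=> u1; have /andP[h1 h2] := rb u u1; have h0 := ltW (r0 u u1).
  by apply/andP; split; apply: lerXn2r; rewrite ?nnegrE// ltW.
have rn0 u : sphere u -> 0 <= rho u ^+ n by move=> /r0/ltW ?; exact: exprn_ge0.
have Wc : E^-1 ^+ n * s <= W.
  have := @ge0_le_Rintegral_affine _ _ R (@sphere_measure R n) sphere sphere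
    (cst (E^-1 ^+ n)) (fun u => rho u ^+ n) 1 0 (E ^+ n).
  rewrite Rintegral_cst// -/s -VE mul1r mul0r addr0; apply => //.
  - move=> u /rn/andP[h1 h2]; rewrite exprn_ge0 ?(ltW Ei0)//=; exact: le_trans h2.
  - by move=> u u1; rewrite rn0//=; case/andP: (rn u u1).
  - by move=> u /rn/andP[h1 h2]; rewrite mul1r addr0.
have WC : W <= E ^+ n * s.
  have := @ge0_le_Rintegral_affine _ _ R (@sphere_measure R n) sphere sphere
    (fun u => rho u ^+ n) (cst (E ^+ n)) 1 0 (E ^+ n).
  rewrite Rintegral_cst// -/s -VE mul1r mul0r addr0; apply => //.
  - by move=> u u1; rewrite rn0//=; case/andP: (rn u u1).
  - by move=> u _; rewrite /= lexx andbT exprn_ge0// ltW.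
  - by move=> u /rn/andP[h1 h2]; rewrite mul1r addr0.
split; first by rewrite Wc (le_trans WC)// -addrA lerDl addr_ge0.
move=> v v1.
pose w u := rho u `^ (n%:R - p).
have Cp1 : C * `|p| <= 1 by rewrite mulrC -ler_pdivlMr// div1r.
have wd u : sphere u -> - (E ^+ n * (C * `|p|)) <= w u - rho u ^+ n <= E ^+ n * (C * `|p|).
  by move=> u1; rewrite -ler_norml; exact: rd.
have En0 : 0 < E ^+ n by rewrite exprn_gt0.
have wB u : sphere u -> 0 <= w u <= B.
  move=> u1; rewrite powR_ge0/=; have := wd u u1; have := rn u u1.
  by rewrite /B; move=> /andP[_ ?] /andP[_ ?]; nra.
have e0 : 0 <= E ^+ n * (C * `|p|) by rewrite !mulr_ge0// ltW.
have rnB u : sphere u -> 0 <= rho u ^+ n <= B.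
  by move=> u1; rewrite rn0//=; case/andP: (rn u u1) => _ ?; rewrite /B; lra.
have Wd : `|\int[@sphere_measure R n]_(u in sphere) w u - W| <= D * `|p|.
  have h1 := @ge0_le_Rintegral_affine _ _ R (@sphere_measure R n) sphere sphere
    w (fun u => rho u ^+ n) 1 (E ^+ n * (C * `|p|)) B mS.
  have h2 := @ge0_le_Rintegral_affine _ _ R (@sphere_measure R n) sphere sphere
    (fun u => rho u ^+ n) w 1 (E ^+ n * (C * `|p|)) B mS.
  have {}h1 := h1 Soo (fun _ => id) ltr01 e0 wB rnB.
  have {}h2 := h2 Soo (fun _ => id) ltr01 e0 rnB wB.
  have a1 u : sphere u -> w u <= 1 * rho u ^+ n + E ^+ n * (C * `|p|).
    by move=> /wd/andP[_ a1]; rewrite mul1r -lerBlDl.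
  have a2 u : sphere u -> rho u ^+ n <= 1 * w u + E ^+ n * (C * `|p|).
    by move=> /wd/andP[+ _]; rewrite lerBrDr addrC mul1r -lerBlDr.
  move: (h1 a1) (h2 a2); rewrite -VE -/s !mul1r.
  have -> : E ^+ n * (C * `|p|) * s = D * `|p| by rewrite /D; ring.
  by move=> b1 b2; rewrite ler_norml lerBlDl b1 lerBrDl lerBlDr b2.
have TE : cosine_transform (- p)
      (fun u => radial (Lp_intersection_body p K) u `^ (n%:R - p)) v =
    \int[@sphere_measure R n]_(u in sphere) (w u * `|dot v u| `^ (- p)).
  apply: eq_Rintegral => u; rewrite inE => u1.
  by rewrite /Lp_intersection_body radial_star_body// ltW// r0.
rewrite TE.
have Td : `|\int[@sphere_measure R n]_(u in sphere) (w u * `|dot v u| `^ (- p)) -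
    \int[@sphere_measure R n]_(u in sphere) w u| <= C2 * `|p|.
  rewrite /C2 -mulrA [_ * `|p|]mulrC.
  clear - n0 mS Sle mrho v1 wB B0 C10 p4.
  have mf : measurable_fun (@sphere R n) (fun u => `|dot v u|).
    by apply: measurable_funTS; apply: measurableT_comp => //; exact: measurable_linear_form.
  have mw : measurable_fun (@sphere R n) w.
    by apply: measurable_funTS; exact: (measurableT_comp (measurable_powR _) mrho).
  apply: (Rintegral_mul_powR_dist mS mf mw _ _ B0 C10 _ _ p4).
  - move=> u u1; rewrite normr_ge0/= -[leRHS]mul1r; apply: dot_sphere_box_le => // i.
    by rewrite in_itv/= -ler_norml; have := coord_le_enorm u i; rewrite u1.
  - by move=> u u1; rewrite ger0_norm; case/andP: (wB u u1).
  - by apply: (le_trans Sle); rewrite lee_fin /C1 le_max lexx.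
  - move=> e' e1; apply: (le_trans (sphere_measure_slab n0 v1 (ltW e1))).
    rewrite lee_fin; apply: (@le_trans _ _ (n%:R * (2 ^+ n.-1 * (n%:R *+ 2)) * e')).
      by rewrite !mulr2n le_eqVlt; apply/orP; left; apply/eqP; ring.
    by rewrite ler_wpM2r ?(ltW e1)// /C1 le_max lexx orbT.
(* The intermediate integral of [w] separates two errors: dropping the kernel costs [C2 * |p|], and
   replacing [rho ^ (n - p)] by [rho ^ n], whose integral is [W], costs [D * |p|]. *)
apply: (le_trans (ler_distD (\int[@sphere_measure R n]_(u in sphere) w u) _ _)).
apply: (le_trans (lerD Td Wd)).
have Es0 : 0 <= E ^+ n * s by rewrite mulr_ge0 ?(ltW En0) ?(ltW s0).
by rewrite -mulrDl ler_wpM2r// -addrA lerDr.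
Qed.

End Lp_intersection_estimates.

(** * Passage to the limit *)

Theorem proposition4 (R : realType) (n : nat) (n_ge2 : (2 <= n)%N)
    (K : set 'rV[R]_n) (K_body : convex_body_o K) (K_volume : volume K = 2)
    (eta : set 'rV[R]_n) (eta_borel : measurable eta)
    (eta_sphere : eta `<=` sphere) :
  2 * `|p| / (n%:R ^+ 2 * volume (Lp_intersection_body p K)) *
    affine_dual_curvature p K eta @[p --> (0 : R)^'] --> cone_volume K eta.
Proof.
have n0 : (0 < n)%N by exact: ltn_trans n_ge2.
have [[cK _ _] K0] := K_body.
have [e e0 eK] := interior_sphere_dilate K0.
have [M M1 KM] := compact_subset_box cK.
have [c [C [d [c0 C0 d0 H]]]] := cosine_transform_estimate n0 cK K_volume.
pose D := reverse_radial_gauss K eta.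
have DS : D `<=` sphere by move=> u [v _ []].
pose r u := radial K u.
pose N := M * n%:R.
have N0 : 0 < N by rewrite mulr_gt0 ?ltr0n// (lt_le_trans ltr01).
have rb u : D u -> e <= r u <= N.
  by move=> /DS u1; apply: radial_bounds => //; exact: eK.
have mS := @measurable_sphere R n.
pose s := fine (sphere_measure (@sphere R n)).
have Soo : (sphere_measure (@sphere R n) < +oo)%E.
  by apply: (le_lt_trans (sphere_measure_le mS)); rewrite ltry.
have s0 : 0 <= s by exact: fine_ge0.
pose A := 4 * (Num.sqrt N + (Num.sqrt e)^-1).
have A0 : 0 <= A by rewrite mulr_ge0// addr_ge0 ?invr_ge0 ?sqrtr_ge0.
pose Q := \int[@sphere_measure R n]_(v in D) (r v ^+ n).
(* The two terms bound those of [r^(n-p) (T - W) + W (r^(n-p) - r^n)] divided by [|p|]: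
   [r^(n-p) <= N^n (1 + A)], [|T - W| <= C |p|], [W <= C], and the last difference is at most
   [N^n A |p|]. *)
pose C3 := N ^+ n * (1 + A) * C + C * (N ^+ n * A).
have Nn0 : 0 <= N ^+ n by rewrite exprn_ge0// ltW.
have C30 : 0 <= C3 by rewrite addr_ge0// !mulr_ge0// ?addr_ge0// ltW.
pose d' := Num.min d 4^-1.
have d'0 : 0 < d' by rewrite lt_min d0 invr_gt0 ltr0n.
(* The first term of the rate comes from the integrand, through [|1 - p| <= 2] and [W >= c]; the
   second comes from the prefactor [1 - p]. *)
apply: (@cvg_dnbhs0_dist R _ _ (2 * (C3 * s) / (n%:R * c) + n%:R^-1 * `|Q|) d') => // p.
rewrite lt_min => /andP[p0 /andP[/ltW pd /ltW p4]].
have /H[/andP[Wc WC] HT] : 0 < `|p| <= d by rewrite p0.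
set V := volume _ in Wc WC HT *.
pose W := n%:R * V.
rewrite -/W in Wc WC HT.
pose T v := cosine_transform (- p)
  (fun u => radial (Lp_intersection_body p K) u `^ (n%:R - p)) v.
have W0 : 0 < W by exact: lt_le_trans Wc.
have p1 : `|p| <= 1 by lra.
have rpd u : D u -> `|r u `^ (n%:R - p) - r u ^+ n| <= N ^+ n * (`|p| * A).
  move=> /rb/andP[re rN]; have r0 : 0 < r u by exact: lt_le_trans re.
  rewrite powRD ?(gt_eqF r0) ?implybT// powR_mulrn ?(ltW r0)//.
  rewrite -[X in _ - X]mulr1 -mulrBr normrM ger0_norm ?exprn_ge0 ?(ltW r0)//.
  apply: ler_pM => //; first by rewrite exprn_ge0// ltW.
    by apply: lerXn2r; rewrite ?nnegrE// ltW.
  apply: (le_trans (norm_powR_sub1 p4 r0)); rewrite ler_wpM2l// ler_wpM2l// lerD//.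
    by rewrite ler_sqrt// ltW.
  by rewrite lef_pV2 ?posrE ?sqrtr_gt0// ler_sqrt// ltW.
have rn u : D u -> 0 <= r u ^+ n <= N ^+ n.
  move=> /rb/andP[re rN]; have r0 : 0 < r u by exact: lt_le_trans re.
  rewrite exprn_ge0 ?(ltW r0)//=; apply: lerXn2r; rewrite ?nnegrE// ltW//.
have rpn u : D u -> 0 <= r u `^ (n%:R - p) <= N ^+ n * (1 + A).
  move=> Du; rewrite powR_ge0/=; have := rpd u Du; rewrite ler_norml => /andP[_ h].
  have /andP[_ h'] := rn u Du.
  have : N ^+ n * (`|p| * A) <= N ^+ n * (1 * A) by rewrite ler_wpM2l// ler_wpM2r.
  by lra.
pose f v := r v `^ (n%:R - p) * T v.
have fd u : D u -> `|f u - W * r u ^+ n| <= C3 * `|p|.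
  move=> Du; have hT := HT u (DS _ Du); rewrite -/(T u) in hT.
  rewrite (_ : f u - _ = r u `^ (n%:R - p) * (T u - W) +
    W * (r u `^ (n%:R - p) - r u ^+ n)); last by rewrite /f; ring.
  apply: (le_trans (ler_normD _ _)); rewrite normrM [X in _ + X]normrM (gtr0_norm W0).
  have /andP[g0 gN] := rpn u Du; rewrite (ger0_norm g0) /C3 mulrDl lerD//.
    by rewrite -mulrA; apply: ler_pM.
  rewrite -[leRHS]mulrA; apply: (ler_pM (ltW W0) (normr_ge0 _) WC).
  have -> : N ^+ n * A * `|p| = N ^+ n * (`|p| * A) by ring.
  exact: rpd.
have T0 u : 0 <= T u.
  by apply: Rintegral_ge0 => w _; rewrite mulr_ge0 ?powR_ge0.
(* This bound only ensures that the integrals over [D] are finite, so it may depend on [p]. *)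
pose B := Num.max (N ^+ n) (W * N ^+ n + C3 * `|p|).
have gB u : D u -> 0 <= r u ^+ n <= B.
  by move=> /rn/andP[-> h] /=; rewrite /B le_max h.
have fB u : D u -> 0 <= f u <= B.
  move=> Du; rewrite mulr_ge0 ?powR_ge0//=.
  have := fd u Du; rewrite ler_norml => /andP[_ h]; have /andP[_ h'] := rn u Du.
  have : W * r u ^+ n <= W * N ^+ n by rewrite ler_wpM2l// ltW.
  by rewrite /B le_max => ?; apply/orP; right; lra.
pose I := \int[@sphere_measure R n]_(v in D) f v.
have E0 : 0 <= C3 * `|p| by rewrite mulr_ge0.
have h1 : I <= W * Q + C3 * `|p| * s.
  apply: (ge0_le_Rintegral_affine mS Soo DS W0 E0 fB gB) => u Du.
  by have := fd u Du; rewrite ler_norml => /andP[_ h]; lra.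
have h2 : Q <= W^-1 * I + W^-1 * (C3 * `|p|) * s.
  have Wi : 0 < W^-1 by rewrite invr_gt0.
  apply: (ge0_le_Rintegral_affine mS Soo DS Wi (mulr_ge0 (ltW Wi) E0) gB fB) => u Du.
  rewrite -mulrDr ler_pdivlMl//.
  by have := fd u Du; rewrite ler_norml => /andP[h _]; lra.
have {}h2 : W * Q <= I + C3 * `|p| * s.
  by rewrite -ler_pdivlMl// mulrDr mulrA.
have n0' : 0 < n%:R :> R by rewrite ltr0n.
have -> : 2 * `|p| / (n%:R ^+ 2 * V) * affine_dual_curvature p K eta =
    (1 - p) / (n%:R * W) * I.
  have -> : affine_dual_curvature p K eta = (1 - p) / (2 * `|p|) * I by [].
  have V0 : V != 0 by apply: contraTneq W0 => V0; rewrite /W V0 mulr0 ltxx.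
  by rewrite /W; field; rewrite V0 !gt_eqF.
have -> : cone_volume K eta = n%:R^-1 * Q by [].
have -> : (1 - p) / (n%:R * W) * I - n%:R^-1 * Q =
    (1 - p) / (n%:R * W) * (I - W * Q) - p * (n%:R^-1 * Q).
  by field; rewrite !gt_eqF.
apply: (le_trans (ler_normB _ _)); rewrite [leRHS]mulrDl lerD//; last first.
  by rewrite normrM normrM (ger0_norm (_ : 0 <= n%:R^-1)) ?invr_ge0// mulrC.
have hI : `|I - W * Q| <= C3 * `|p| * s.
  by rewrite ler_norml; apply/andP; split; lra.
rewrite normrM (_ : 2 * _ / _ * _ = 2 / (n%:R * c) * (C3 * `|p| * s)); last first.
  by field; rewrite !gt_eqF.
apply: ler_pM => //.
have nW0 : 0 < n%:R * W by exact: mulr_gt0 n0' W0.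
rewrite normrM (ger0_norm (_ : 0 <= (n%:R * W)^-1)) ?invr_ge0 ?(ltW nW0)//.
apply: ler_pM => //; first by rewrite invr_ge0 ltW.
  by apply: (le_trans (ler_normB _ _)); rewrite normr1; lra.
have cW : n%:R * c <= n%:R * W by exact: ler_wpM2l (ltW n0') _ _ Wc.
by rewrite lef_pV2 ?posrE//; exact: mulr_gt0 n0' c0.
Qed.
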